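(* Let $n\ge2$ and $\alpha,\beta,u,v\in\mathbb R^n$. Put $p_\varepsilon=P_{\alpha+\varepsilon u}$, $q_\varepsilon=P_{\beta+\varepsilon v}$, $h_\varepsilon=p_\varepsilon\boxplus_nq_\varepsilon$ for real $\varepsilon$. Let $a$ be a root of $p_0$ and $b$ a root of $q_0$, let $I=\{i:\alpha_i=a\}$, $J=\{j:\beta_j=b\}$, $m=|I|$, $k=|J|$, and suppose $r=m+k-n>0$. Let $U(z)=\prod_{i\in I}(z-u_i)$ and $V(z)=\prod_{j\in J}(z-v_j)$. Define the monic degree-$r$ polynomial $$Q(z)=\left(\frac{r!}{m!}U^{(m-r)}(z)\right)\boxplus_r\left(\frac{r!}{k!}V^{(k-r)}(z)\right)$$ and the nonzero real constant $$c_{\mathrm{tan}}=\frac{m!\,k!}{n!\,r!}\prod_{i\notin I}(a-\alpha_i)\prod_{j\notin J}(b-\beta_j).$$ There is a polynomial $R\in\mathbb R[z,\varepsilon]$ such that $$h_\varepsilon(a+b+\varepsilon z)=\varepsilon^r\bigl(c_{\mathrm{tan}}Q(z)+\varepsilon R(z,\varepsilon)\bigr).$$ In particular, as $\varepsilon\to0$, $\varepsilon^{-r}h_\varepsilon(a+b+\varepsilon z)$ converges coefficientwise, and locally uniformly for $z\in\mathbb C$, to $c_{\mathrm{tan}}Q(z)$. The $r$ roots of $h_\varepsilon$ approaching $a+b$ as $\varepsilon\to0$, after subtraction of $a+b$ and division by $\varepsilon$, converge as an unordered multiset to the roots of $Q$. If the roots of $Q$ are distinct, say $\lambda_1<\cdots<\lambda_r$,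 the corresponding roots of $h_\varepsilon$ admit real analytic branches $x_1(\varepsilon),\ldots,x_r(\varepsilon)$ through the parameter value $\varepsilon=0$, with $$x_j(\varepsilon)=a+b+\varepsilon\lambda_j+O(\varepsilon^2),\qquad 1\le j\le r.$$ Within this cluster, (for $\varepsilon$ near $0$) the branches $x_1,\dots,x_r$ are increasingly ordered for positive $\varepsilon$ and decreasingly ordered for negative $\varepsilon$.
   Context: $P_\alpha(x)=\prod_{i=1}^n(x-\alpha_i)$. Finite free additive convolution in degree $d\ge1$: for $p(x)=\sum_{k=0}^d(-1)^ka_kx^{d-k}$ and $q(x)=\sum_{k=0}^d(-1)^kb_kx^{d-k}$ with $a_0=b_0=1$, set $(p\boxplus_d q)(x)=\sum_{k=0}^d(-1)^kc_kx^{d-k}$ with $c_k=\sum_{i+j=k}\frac{(d-i)!(d-j)!}{d!(d-k)!}a_ib_j$ (so $(z-a)\boxplus_1(z-b)=z-a-b$). It preserves real-rootedness (Walsh). $U^{(j)}$ denotes the $j$-th derivative. *)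

(* Defs.v *)
From HB Require Import structures.
From mathcomp Require Import all_boot all_order all_algebra.
From mathcomp Require Import complex.
From mathcomp Require Import all_classical all_reals all_analysis.

Set Implicit Arguments.
Unset Strict Implicit.
Unset Printing Implicit Defensive.

Import Order.TTheory GRing.Theory Num.Theory.
Import numFieldNormedType.Exports.

Local Open Scope classical_set_scope.
Local Open Scope ring_scope.

Definition root_poly (R : nzRingType) (n : nat) (alpha : 'rV[R]_n) : {poly R} :=
  \prod_(i < n) ('X - (alpha 0 i)%:P).

(* the number a_k in p(x) = \sum_(k <= d) (-1)^k a_k x^(d - k) *)
Definition signed_coef (R : nzRingType) (d : nat) (p : {poly R}) (k : nat) : R :=
  (-1) ^+ k * p`_(d - k).

(* Finite free additive convolution in degree d; meaningful when p and q are
   monic of degree d. *)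
Definition free_conv (R : fieldType) (d : nat) (p q : {poly R}) : {poly R} :=
  \sum_(k < d.+1)
    ((-1) ^+ k *
     \sum_(i < d.+1) \sum_(j < d.+1 | (i + j == k)%N)
        ((d - i)`! * (d - j)`!)%:R / (d`! * (d - k)`!)%:R
        * signed_coef d p i * signed_coef d q j) *: 'X^(d - k).

(* a real polynomial viewed as a complex one *)
Definition cpoly (R : realType) (p : {poly R}) : {poly R[i]} :=
  map_poly (real_complex R) p.

(* the complex roots of p (for p != 0), listed with multiplicity in an
   unspecified order *)
Definition croots (R : realType) (p : {poly R}) : seq R[i] :=
  sval (closed_field_poly_normal (cpoly p)).

Definition croots_near (R : realType) (c rho : R) (p : {poly R}) : seq R[i] :=
  [seq w <- croots p | `|w - c%:C%C| < rho%:C%C].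

(* Convergence of finite multisets of complex numbers, represented by sequences
   up to permutation: eventually the members of s e can be matched bijectively
   with those of t so that matched members are eta-close. *)
Definition mset_cvg (R : realType) (T : Type) (F : set_system T)
    (s : T -> seq R[i]) (t : seq R[i]) : Prop :=
  forall eta : R, 0 < eta -> \forall e \near F,
    exists2 t' : seq R[i], perm_eq t' (s e) &
      all2 (fun w w' => `|w - w'| < eta%:C%C) t' t.

(* f is the sum of a convergent power series centred at x, on a neighbourhood
   of x *)
Definition real_analytic_at (R : realType) (f : R -> R) (x : R) : Prop :=
  exists c : R^nat, \forall y \near x, pseries c (y - x) @ \oo --> f y.

Definition locally_uniform_cvg (R : realType) (F : set_system R)
    (f : R -> R[i]^o -> R[i]^o) (g : R[i]^o -> R[i]^o) : Prop :=
  forall z : R[i]^o, exists2 A : set R[i]^o, nbhs z A & {uniform A, f @ F --> g}.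

(* Main.v *)
(* With x + y kept fixed, n! (p [+]_n q)(x + y) is the Taylor pairing
   \sum_t q^(t)(y) p^(n - t)(x); hence [+]_n commutes with affine zooms:
   p(a + eps z) [+]_n q(b + eps z) = eps^n (p [+]_n q)(a + b + eps z).  Since
   p_eps(a + eps z) = eps^m U(z) A_eps(z) and q_eps(b + eps z) = eps^k V(z) B_eps(z),
   with A_0 and B_0 constant, h_eps(a + b + eps z) is eps^r times a polynomial
   family whose value at eps = 0 is A_0 B_0 (U [+]_n V) = c_tan Q.

   Roots of monic polynomials depend continuously on the coefficients (some root
   w has |z - w|^n <= |p(z)|; deflate and iterate), so h_eps splits into a
   cluster factor and a far factor; after rescaling the far factor tends to a
   nonzero constant, so the rescaled cluster factor tends to Q.

   Q is real-rooted by Walsh's theorem, proved by iterated polar derivatives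
   d p + (zeta - z) p', which keep the zeros of p in the closed lower half-plane
   when Im zeta > 0.  At a simple root, the fixed-point iteration for power
   series stays bounded in a weighted l^1 norm and gains one exact coefficient
   per step, which yields convergent power series for the branches. *)

Require Import Defs.
From mathcomp Require Import all_boot all_order all_algebra.
From mathcomp Require Import complex polyXY.
From mathcomp Require Import all_classical all_reals all_analysis.
From mathcomp Require Import ring lra zify.

Set Implicit Arguments.
Unset Strict Implicit.
Unset Printing Implicit Defensive.

Import Order.TTheory GRing.Theory Num.Theory.
Import numFieldNormedType.Exports.

Local Open Scope classical_set_scope.
Local Open Scope ring_scope.

(** * Finite free convolution *)

Section FreeConv.
Variable F : numFieldType.
Implicit Types p q : {poly F}.

Lemma poly_ext p q : (forall x, p.[x] = q.[x]) -> p = q.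
Proof.
move=> pq; apply/eqP; rewrite -subr_eq0; apply/eqP.
apply: (@roots_geq_poly_eq0 _ _ [seq (i%:R : F) | i <- iota 0 (size (p - q))]).
- by apply/allP => x _; rewrite rootE !hornerE pq subrr.
- by rewrite map_inj_uniq ?iota_uniq // => i j /eqP; rewrite eqr_nat => /eqP.
- by rewrite size_map size_iota.
Qed.

(** The factorials of the convolution come from differentiation: with [t = d - j], the value at 0 of
    the t-th derivative of [q] carries (d-j)!, and the j-th derivative of X^(d-i) carries
    (d-i)!/(d-i-j)!. *)
Lemma free_convE d p q : (size p <= d.+1)%N ->
  d`!%:R *: free_conv d p q = \sum_(t < d.+1) (q^`(t)).[0] *: p^`(d - t).
Proof.
move=> sp.
have fz (k : nat) : (k`!%:R != 0 :> F) by rewrite pnatr_eq0 -lt0n fact_gt0.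
have pE : p = \sum_(i < d.+1) p`_(d - i) *: 'X^(d - i).
  rewrite -{1}(coefK p) (@poly_def _ _ _).
  rewrite (big_ord_widen _ (fun i => p`_i *: 'X^i) sp) big_mkcond /=.
  rewrite (reindex_inj rev_ord_inj) /=; apply: eq_bigr => i _.
  rewrite subSS; case: ltnP => // ip.
  by rewrite nth_default // scale0r.
rewrite (reindex_inj rev_ord_inj) /=.
(* [f i j] is the contribution of the coefficients of index [d - i] and [d - j]; both sides become
   its sum over [i + j <= d]. *)
pose f (i j : nat) : {poly F} := (((d - i)`! * (d - j)`!)%:R / (d - (i + j))`!%:R
   * p`_(d - i) * q`_(d - j)) *: 'X^(d - (i + j)).
transitivity (\sum_(j < d.+1) \sum_(i < d.+1 | (i + j < d.+1)%N) f i j).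
  rewrite /free_conv scaler_sumr.
  transitivity (\sum_(k < d.+1) \sum_(i < d.+1) \sum_(j < d.+1 | (i + j == k)%N) f i j).
    apply: eq_bigr => k _; rewrite scalerA mulrA mulr_sumr scaler_suml.
    apply: eq_bigr => i _; rewrite mulr_sumr scaler_suml.
    apply: eq_bigr => j /eqP ijk; rewrite /f ijk; congr (_ *: _).
    (* The sign of index [k = i + j] cancels the two signs inside [signed_coef]. *)
    have s1 : (-1) ^+ k = (-1) ^+ i * (-1) ^+ j :> F by rewrite -exprD ijk.
    have := signrMK i (1 : F); have := signrMK j (1 : F).
    rewrite !mulr1 /signed_coef s1 => ej ei.
    rewrite !natrM !invfM.
    transitivity (((-1) ^+ i * (-1) ^+ i) * ((-1) ^+ j * (-1) ^+ j) * (d`!%:R / d`!%:R) *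
      ((d - i)`!%:R * (d - j)`!%:R / (d - k)`!%:R * p`_(d - i) * q`_(d - j)) : F).
      by ring.
    by rewrite ei ej divff // !mul1r.
  rewrite exchange_big /= [RHS](exchange_big_dep xpredT) //=.
  apply: eq_bigr => i _.
  rewrite (exchange_big_dep (fun j : 'I_d.+1 => (i + j < d.+1)%N)) /=; last first.
    by move=> k j _ /eqP ->.
  apply: eq_bigr => j ij.
  by rewrite (big_pred1 (Ordinal ij)) // => k; rewrite -val_eqE /= eq_sym.
apply: eq_bigr => j _; rewrite subSS (subKn (leq_ord j)).
rewrite horner_coef0 coef_derivn addn0.
rewrite {1}pE linear_sum scaler_sumr big_mkcond /=; apply: eq_bigr => i _.
rewrite linearZ /= derivnXn scalerA ltnS.
case: leqP => ij; last first.
  have -> : ((d - i) ^_ j = 0)%N by apply: ffact_small; move: ij (leq_ord i); lia.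
  by rewrite mulr0n scaler0.
rewrite /f subnDA.
rewrite -[X in _ = _ *: X]scaler_nat scalerA; congr (_ *: _).
have -> : ((d - i) ^_ j)%:R = (d - i)`!%:R / (d - (i + j))`!%:R :> F.
  have e := @ffact_fact (d - i) j ltac:(lia).
  by rewrite -e natrM -subnDA mulfK.
by rewrite -[_ *+ _]mulr_natl ffactnn !natrM subnDA; ring.
Qed.

(* The derivative in s of \sum_t q^(t)(y + s) p^(d - t)(x - s) telescopes to 0. *)
Lemma taylor_pairing_shift d p q x y s :
  (size p <= d.+1)%N -> (size q <= d.+1)%N ->
  \sum_(t < d.+1) (q^`(t)).[y + s] * (p^`(d - t)).[x - s] =
  \sum_(t < d.+1) (q^`(t)).[y] * (p^`(d - t)).[x].
Proof.
move=> sp sq.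
pose phi := \sum_(t < d.+1) (q^`(t) \Po (y%:P + 'X)) * (p^`(d - t) \Po (x%:P - 'X)).
have phiE w : phi.[w] = \sum_(t < d.+1) (q^`(t)).[y + w] * (p^`(d - t)).[x - w].
  by rewrite horner_sum; apply: eq_bigr => t _; rewrite !hornerE !horner_comp !hornerE.
rewrite -phiE.
suff phi0 : phi^`() = 0.
  have -> : phi = (phi.[0])%:P.
    apply/polyP => -[|i]; first by rewrite coefC eqxx horner_coef0.
    have /(congr1 (coefp i)) := phi0; rewrite /= coef_deriv coef0 coefC /= => /eqP.
    by rewrite mulrn_eq0 /= => /eqP.
  by rewrite hornerC phiE; apply: eq_bigr => t _; rewrite addr0 subr0.
(* The two ends of the telescoping sum contain a derivative of order [d + 1], which vanishes. *)
have dp : p^`(d.+1) = 0 by apply: derivn_poly0.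
have dq : q^`(d.+1) = 0 by apply: derivn_poly0.
pose g t := (q^`(t) \Po (y%:P + 'X)) * (p^`(d.+1 - t) \Po (x%:P - 'X)).
rewrite /phi linear_sum /=.
rewrite (eq_bigr (fun t : 'I_d.+1 => g t.+1 - g t)); last first.
  move=> t _; rewrite derivM !deriv_comp derivD derivB !derivC derivX add0r mulr1 sub0r.
  rewrite -!derivnS /g subSS (subSn (leq_ord t)).
  by rewrite mulrN1 mulrN.
rewrite -(big_mkord xpredT (fun t => g t.+1 - g t)) telescope_sumr // /g.
by rewrite subn0 dp dq !comp_poly0 mul0r mulr0 subrr.
Qed.

(** [free_convE] is the pairing based at 0 and [x + y]; shifting by [y] rebalances it to [y] and
    [x]. *)
Lemma horner_free_conv d p q x y :
  (size p <= d.+1)%N -> (size q <= d.+1)%N ->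
  d`!%:R * (free_conv d p q).[x + y] =
  \sum_(t < d.+1) (q^`(t)).[y] * (p^`(d - t)).[x].
Proof.
move=> sp sq; rewrite -hornerZ free_convE // horner_sum.
under eq_bigr do rewrite hornerZ.
rewrite -[in RHS](taylor_pairing_shift x y (- y) sp sq) subrr opprK.
by [].
Qed.

End FreeConv.

(** * Affine zooms and reduction of the degree *)

Section FreeConvZoom.
Variable F : numFieldType.
Implicit Types p q : {poly F}.

Lemma fact_neq0 k : (k`!%:R != 0 :> F).
Proof. by rewrite pnatr_eq0 -lt0n fact_gt0. Qed.

Lemma derivnD p i j : p^`(i)^`(j) = p^`(i + j).
Proof. by rewrite addnC /derivn iterD. Qed.

Lemma size_derivn p i : size p^`(i) = (size p - i)%N.
Proof.
have [ip|pi] := ltnP i (size p); last first.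
  by rewrite derivn_poly0 // size_poly0; apply/esym/eqP; rewrite subn_eq0.
apply/eqP; rewrite eqn_leq; apply/andP; split.
  apply/leq_sizeP => j; rewrite leq_subLR => sj.
  by rewrite coef_derivn nth_default // mul0rn.
rewrite leqNgt; apply/negP => lt.
have := @nth_default _ 0 (p^`(i)) ((size p).-1 - i)%N.
have -> : (size p^`(i) <= (size p).-1 - i)%N by move: lt ip; lia.
move=> /(_ isT) /eqP; rewrite coef_derivn subnKC; last by move: ip; lia.
rewrite mulrn_eq0 -lead_coefE lead_coef_eq0 -size_poly_eq0.
have -> : ((size p).-1 ^_ i == 0 = false)%N.
  by apply/negbTE; rewrite -lt0n ffact_gt0; move: ip; lia.
by move=> /eqP p0; move: ip; rewrite p0.
Qed.

Lemma derivn_comp_affine p a e i :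
  (p \Po (a%:P + e *: 'X))^`(i) = e ^+ i *: (p^`(i) \Po (a%:P + e *: 'X)).
Proof.
elim: i => [|i IH]; first by rewrite scale1r.
rewrite derivnS IH linearZ /= deriv_comp derivD derivC derivZ derivX add0r.
by rewrite -derivnS exprSr -scalerA -scalerAr mulr1.
Qed.

Lemma size_comp_affine p a e : (size (p \Po (a%:P + e *: 'X)) <= size p)%N.
Proof.
have [->|p0] := eqVneq p 0; first by rewrite comp_poly0 size_poly0.
apply: (leq_trans (size_comp_poly_leq _ _)).
have le2 : (size (a%:P + e *: 'X)%R <= 2)%N.
  rewrite (leq_trans (size_polyD _ _)) // geq_max (leq_trans (size_polyC_leq1 _)) //=.
  by rewrite (leq_trans (size_scale_leq _ _)) ?size_polyX.
have sp : (0 < size p)%N by rewrite size_poly_gt0.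
rewrite -[leqRHS](prednK sp) ltnS -[leqRHS]muln1 leq_mul2l; apply/orP; right.
by rewrite -ltnS (leq_trans (leqSpred _)) //; case: (size _) le2 => [|[|]].
Qed.

(** The chain rule multiplies the t-th term of the pairing by [e ^+ t * e ^+ (d - t)], a power that
    does not depend on [t]. *)
Lemma free_conv_affine d p q a b e :
  (size p <= d.+1)%N -> (size q <= d.+1)%N ->
  free_conv d (p \Po (a%:P + e *: 'X)) (q \Po (b%:P + e *: 'X)) =
  e ^+ d *: (free_conv d p q \Po ((a + b)%:P + e *: 'X)).
Proof.
move=> sp sq; apply: poly_ext => x; apply: (mulfI (fact_neq0 d)).
rewrite -{1}[x]addr0 horner_free_conv; try exact: leq_trans (size_comp_affine _ _ _) _.
rewrite hornerZ horner_comp !hornerE [X in _ = X * _]mulrC -mulrA.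
have -> : a + b + e * x = (a + e * x) + b by ring.
rewrite horner_free_conv // mulr_sumr; apply: eq_bigr => t _.
rewrite !derivn_comp_affine !hornerZ !horner_comp !hornerE ?mulr0 ?addr0.
have -> : e ^+ d = e ^+ t * e ^+ (d - t) by rewrite -exprD subnKC ?leq_ord.
by rewrite /=; ring.
Qed.

Lemma free_convZ d p q c c' :
  free_conv d (c *: p) (c' *: q) = (c * c') *: free_conv d p q.
Proof.
rewrite /free_conv scaler_sumr; apply: eq_bigr => k _.
rewrite scalerA mulrCA; congr ((_ * _) *: _).
rewrite mulr_sumr; apply: eq_bigr => i _; rewrite mulr_sumr; apply: eq_bigr => j _.
by rewrite /signed_coef !coefZ; ring.
Qed.

(** With [p] of degree at most [m] and [q] of degree at most [k], the pairing in degree [n] only has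
    terms for [k - r <= t <= k]; shifting the index by [k - r = n - m] leaves the pairing in degree
    [r] of the two derivatives. *)
Lemma free_conv_derivn n m k r p q : (size p <= m.+1)%N -> (size q <= k.+1)%N ->
  (m <= n)%N -> (k <= n)%N -> (m + k = n + r)%N ->
  n`!%:R *: free_conv n p q = r`!%:R *: free_conv r p^`(m - r) q^`(k - r).
Proof.
move=> sp sq mn kn mk.
rewrite free_convE; last by apply: leq_trans sp _; lia.
rewrite free_convE; last by rewrite size_derivn; move: sp mk kn; lia.
pose f t := (q^`(t)).[0] *: p^`(n - t).
rewrite -(big_mkord xpredT f) (@big_cat_nat _ _ _ (k - r)%N) /=; [|lia|lia].
rewrite [X in X + _]big_nat_cond big1 ?add0r; last first.
  move=> t /andP[/andP[_ t1] _]; rewrite /f [p^`(_)]derivn_poly0 ?scaler0 //.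
  by apply: leq_trans sp _; lia.
rewrite (@big_cat_nat _ _ _ k.+1) /=; [|lia|lia].
rewrite [X in _ + X]big_nat_cond [X in _ + X]big1 ?addr0; last first.
  move=> t /andP[/andP[t1 _] _]; rewrite /f [q^`(t)]derivn_poly0 ?horner0 ?scale0r //.
  by apply: leq_trans sq _; lia.
have -> : k.+1 = (r.+1 + (k - r))%N by lia.
rewrite -[X in \sum_(X <= _ < _) _]add0n big_addn addnK big_mkord.
apply: eq_bigr => t _; have tr := leq_ord t.
by rewrite /f !derivnD addnC; congr (_ *: p^`(_)); lia.
Qed.

Lemma coef_free_conv_top d p q : (size p <= d.+1)%N ->
  (free_conv d p q)`_d = p`_d * q`_d.
Proof.
move=> sp; apply: (mulfI (fact_neq0 d)); rewrite -(coefZ d`!%:R (free_conv d p q)) free_convE // coef_sum.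
rewrite big_ord_recr /= subnn big1 ?add0r.
  by rewrite coefZ horner_coef0 coef_derivn addn0 ffactnn -mulr_natl; ring.
move=> t _; rewrite coefZ coef_derivn nth_default ?mul0rn ?mulr0 //.
by apply: leq_trans sp _; case: t => t /= ?; lia.
Qed.

Lemma size_free_conv d p q : (size (free_conv d p q) <= d.+1)%N.
Proof.
apply: (leq_trans (size_sum _ _ _)); apply/bigmax_leqP => k _.
apply: (leq_trans (size_scale_leq _ _)).
by rewrite size_polyXn ltnS leq_subr.
Qed.

Lemma free_conv_monic d p q : p \is monic -> q \is monic ->
  size p = d.+1 -> size q = d.+1 ->
  free_conv d p q \is monic /\ size (free_conv d p q) = d.+1.
Proof.
move=> /monicP lp /monicP lq sp sq.
have e1 : (free_conv d p q)`_d = 1.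
  rewrite coef_free_conv_top ?sp //; move: lp lq; rewrite !lead_coefE sp sq /=.
  by move=> -> ->; rewrite mulr1.
have sf : size (free_conv d p q) = d.+1.
  apply/eqP; rewrite eqn_leq size_free_conv ltnNge; apply/negP => /leq_sizeP/(_ d (leqnn _)).
  by rewrite e1 => /eqP; rewrite oner_eq0.
by split => //; apply/monicP; rewrite lead_coefE sf.
Qed.

Lemma derivn_monic_scaled p m r : (r <= m)%N -> p \is monic -> size p = m.+1 ->
  let p1 := (r`!%:R / m`!%:R) *: p^`(m - r) in p1 \is monic /\ size p1 = r.+1.
Proof.
move=> rm /monicP lp sp p1.
have e1 : p1`_r = 1.
  rewrite coefZ coef_derivn subnK //.
  move: lp; rewrite lead_coefE sp /= => ->.
  have e := ffact_fact (leq_subr r m); rewrite subKn // in e.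
  have nz := fact_neq0 m; rewrite -e natrM mulf_eq0 negb_or in nz.
  by case/andP: nz => n1 n2; rewrite -e natrM; field; rewrite n1 n2.
have le : (size p1 <= r.+1)%N.
  apply: leq_trans (size_scale_leq _ _) _.
  by rewrite size_derivn sp; move: rm; lia.
have sf : size p1 = r.+1.
  apply/eqP; rewrite eqn_leq le ltnNge; apply/negP => /leq_sizeP/(_ r (leqnn _)).
  by rewrite e1 => /eqP; rewrite oner_eq0.
by split => //; apply/monicP; rewrite lead_coefE sf.
Qed.

(** * Families depending polynomially on a parameter *)

Definition poly_family (f : F -> {poly F}) :=
  exists S : {poly {poly F}}, forall e, f e = S.[e%:P].

Lemma poly_family_cst p : poly_family (fun=> p).
Proof. by exists p%:P => e; rewrite hornerC. Qed.

Lemma poly_familyD (f g : F -> {poly F}) : poly_family f -> poly_family g ->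
  poly_family (fun e => f e + g e).
Proof. by move=> [S fS] [T gT]; exists (S + T) => e; rewrite fS gT hornerD. Qed.

Lemma poly_familyM (f g : F -> {poly F}) : poly_family f -> poly_family g ->
  poly_family (fun e => f e * g e).
Proof. by move=> [S fS] [T gT]; exists (S * T) => e; rewrite fS gT hornerM. Qed.

Lemma poly_family_sum I (s : seq I) (P : pred I) f : (forall i, poly_family (f i)) ->
  poly_family (fun e => \sum_(i <- s | P i) f i e).
Proof.
move=> hf; elim: s => [|i s IH].
  by under eq_fun do rewrite big_nil; exact: poly_family_cst.
under eq_fun do rewrite big_cons.
by case: (P i) => //; exact: poly_familyD.
Qed.

Lemma poly_family_prod I (s : seq I) (P : pred I) f : (forall i, poly_family (f i)) ->
  poly_family (fun e => \prod_(i <- s | P i) f i e).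
Proof.
move=> hf; elim: s => [|i s IH].
  by under eq_fun do rewrite big_nil; exact: poly_family_cst.
under eq_fun do rewrite big_cons.
by case: (P i) => //; exact: poly_familyM.
Qed.

Lemma poly_familyZ f : poly_family f -> poly_family (fun e => e *: f e).
Proof. by move=> [S fS]; exists ('X * S) => e; rewrite hornerM hornerX mul_polyC fS. Qed.

(** The powers of the parameter are scalars, so [L] can be applied to each coefficient of the
    witness. *)
Lemma poly_family_linear (L : {poly F} -> {poly F}) f : linear L ->
  poly_family f -> poly_family (fun e => L (f e)).
Proof.
move=> linL [S fS]; under eq_fun do rewrite fS.
have L0 : L 0 = 0.
  by have := linL (-1) 0 0; rewrite scaleN1r oppr0 addr0 scaleN1r addNr.
elim/poly_ind: S {fS} => [|S c [T IH]].
  by under eq_fun do rewrite horner0 L0; exact: poly_family_cst.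
exists (T * 'X + (L c)%:P) => e.
by rewrite !hornerMXaddC -IH ![_ * e%:P]mulrC !mul_polyC linL.
Qed.

Lemma poly_family_free_conv d (f g : F -> {poly F}) : (forall e, (size (f e) <= d.+1)%N) ->
  poly_family f -> poly_family g -> poly_family (fun e => free_conv d (f e) (g e)).
Proof.
move=> sf hf hg.
pose L t (p : {poly F}) : {poly F} := (p^`(t)).[0]%:P.
have -> : (fun e => free_conv d (f e) (g e)) = (fun e => (d`!%:R^-1)%:P *
    \sum_(t < d.+1) (L t (g e) * (f e)^`(d - t))).
  apply/funext => e.
  apply: (scalerI (fact_neq0 d)).
  rewrite free_convE // mul_polyC scalerA mulfV ?fact_neq0 // scale1r.
  by apply: eq_bigr => t _; rewrite mul_polyC.
apply: poly_familyM; first exact: poly_family_cst.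
apply: poly_family_sum => t; apply: poly_familyM; apply: poly_family_linear => //.
- by move=> c u v; rewrite /L linearP /= hornerD hornerZ -mul_polyC polyCD polyCM.
- exact: linearP.
Qed.

(** Splitting off the constant term in the parameter; this produces the remainder in the expansion
    of the zoomed convolution. *)
Lemma poly_family_split f : poly_family f ->
  exists S : {poly {poly F}}, forall e, f e = f 0 + e *: S.[e%:P].
Proof.
move=> [T fT]; elim/poly_ind: T fT => [|T c _] fT.
  by exists 0 => e; rewrite !fT !horner0 scaler0 addr0.
exists T => e.
by rewrite !fT !hornerMXaddC mulr0 add0r addrC mulrC mul_polyC.
Qed.

(** * Zooming on a root of [root_poly] *)

Section Zoom.
Variables (n : nat) (alpha u : 'rV[F]_n) (a : F).
Let I := [set i : 'I_n | alpha 0 i == a]%SET.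

(** The factors with [alpha 0 i != a], which tend to nonzero constants under the zoom and hence
    contribute no power of [e]. *)
Definition zoom_cofactor (e : F) : {poly F} :=
  \prod_(i | i \notin I) ((a - alpha 0 i)%:P + e *: ('X - (u 0 i)%:P)).

(** A factor with [alpha 0 i = a] becomes [e] times X - u_i once [a] cancels, so each such index
    gives one power of [e]. *)
Lemma root_poly_zoom e : root_poly (alpha + e *: u) \Po (a%:P + e *: 'X) =
  e ^+ #|I| *: ((\prod_(i in I) ('X - (u 0 i)%:P)) * zoom_cofactor e).
Proof.
rewrite /root_poly rmorph_prod (bigID (mem I)) /= scalerAl; congr (_ * _).
  rewrite -scaler_prodl; apply: eq_bigr => i; rewrite inE => /eqP <-.
  rewrite !mxE comp_polyB comp_polyX comp_polyC polyCD polyCM.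
  by rewrite -!mul_polyC; ring.
apply: eq_bigr => i _.
rewrite !mxE comp_polyB comp_polyX comp_polyC polyCD polyCM.
by rewrite -!mul_polyC polyCB; ring.
Qed.

Lemma poly_family_zoom : poly_family (fun e =>
   (\prod_(i in I) ('X - (u 0 i)%:P)) * zoom_cofactor e).
Proof.
apply: poly_familyM; first exact: poly_family_cst.
apply: poly_family_prod => i; apply: poly_familyD; first exact: poly_family_cst.
by apply: poly_familyZ; exact: poly_family_cst.
Qed.

Lemma zoom_cofactor0 : zoom_cofactor 0 = (\prod_(i | i \notin I) (a - alpha 0 i))%:P.
Proof. by rewrite rmorph_prod; apply: eq_bigr => i _; rewrite scale0r addr0. Qed.

Lemma size_prod_in : size (\prod_(i in I) ('X - (u 0 i)%:P)) = #|I|.+1.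
Proof. by rewrite -big_enum size_prod_XsubC -cardE. Qed.

Lemma size_zoom e :
  (size ((\prod_(i in I) ('X - (u 0 i)%:P)) * zoom_cofactor e)%R <= n.+1)%N.
Proof.
apply: leq_trans (size_polyMleq _ _) _; rewrite size_prod_in /=.
suff le : (size (zoom_cofactor e) <= (n - #|I|).+1)%N.
  have In : (#|I| <= n)%N by rewrite -[X in (_ <= X)%N]card_ord max_card.
  apply: leq_trans (leq_add (leqnn _) le) _; rewrite addnS ltnS subnKC //.
apply: leq_trans (size_poly_prod_leq _ _) _.
have cn : (#|I| + #|[pred i | i \notin I]| = n)%N.
  by rewrite -[RHS](card_ord n) -(cardC (mem I)); congr (_ + _)%N; apply: eq_card.
have le2 : (\sum_(i | i \notin I) size ((a - alpha 0 i)%:P + e *: ('X - (u 0 i)%:P))%R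
    <= \sum_(i | i \notin I) 2)%N.
  apply: leq_sum => i _.
  rewrite (leq_trans (size_polyD _ _)) // geq_max (leq_trans (size_polyC_leq1 _)) //=.
  by rewrite (leq_trans (size_scale_leq _ _)) ?size_XsubC.
rewrite sum_nat_const in le2.
by move: le2 cn; rewrite -!/(#|_|); lia.
Qed.

End Zoom.
End FreeConvZoom.

(** * Walsh's theorem: real-rootedness *)

Section Walsh.
Variable R : rcfType.
Local Notation C := R[i].
Implicit Types (p q : {poly C}) (z zeta : C).

(** Non-vanishing on the open upper half-plane; this half-plane suffices for real-rootedness because
    the roots of a real polynomial come in conjugate pairs. *)
Definition upper_stable p := forall z, 0 < complex.Im z -> p.[z] != 0.

Lemma upper_stable_roots p : upper_stable p -> exists2 s : seq C,
  p = lead_coef p *: \prod_(w <- s) ('X - w%:P) & all (fun w => complex.Im w <= 0) s.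
Proof.
move=> sp; have [s ps] := closed_field_poly_normal p.
exists s => //; apply/allP => w ws; rewrite leNgt; apply/negP => /sp.
rewrite ps hornerZ [X in _ * X](_ : _ = 0) ?mulr0 ?eqxx //.
by apply/eqP; rewrite -rootE root_prod_XsubC.
Qed.

Lemma deriv_prod_XsubC_horner (s : seq C) z : all (fun w => z != w) s ->
  (\prod_(w <- s) ('X - w%:P))^`().[z] =
  (\prod_(w <- s) ('X - w%:P)).[z] * \sum_(w <- s) (z - w)^-1.
Proof.
elim: s => [|w s IH] /=; first by rewrite !big_nil derivC !hornerE.
case/andP => zw zs; rewrite !big_cons derivM derivXsubC !hornerE IH //.
by rewrite mulrDr mulrA [in RHS]mulrAC divff ?subr_eq0 // mul1r; ring.
Qed.

Lemma Im_sum (s : seq C) (f : C -> C) :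
  complex.Im (\sum_(w <- s) f w) = \sum_(w <- s) complex.Im (f w).
Proof. by elim: s => [|w s IH]; rewrite ?big_nil // !big_cons -IH; case: (f w) (\sum_(_ <- _) _) => ? ? []. Qed.

Lemma Im_inv_lt0 (x : C) : 0 < complex.Im x -> complex.Im x^-1 < 0.
Proof.
case: x => a b /= b0; rewrite ?mulNr oppr_lt0 divr_gt0 //.
by rewrite ltr_wpDl ?sqr_ge0 // exprn_gt0.
Qed.

(** Gauss-Lucas for a half-plane: p'/p is the sum of the 1/(z - w), and each term has negative
    imaginary part when [Im w <= 0 < Im z]. *)
Lemma upper_stable_deriv p : (1 < size p)%N -> upper_stable p -> upper_stable p^`().
Proof.
move=> p1 sp z z0; have [s ps s0] := upper_stable_roots sp.
have pz := sp z z0.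
have zs : all (fun w => z != w) s.
  apply/allP => w /(allP s0) w0; apply/eqP => zw; move: z0.
  by rewrite zw ltNge w0.
have pE : p^`().[z] = p.[z] * \sum_(w <- s) (z - w)^-1.
  by rewrite ps derivZ !hornerZ deriv_prod_XsubC_horner // mulrA.
rewrite pE mulf_neq0 //; apply/eqP => /(congr1 (@complex.Im R)).
rewrite Im_sum /=.
have : (0 < size s)%N.
  move: p1; rewrite ps; case: (s) => //; rewrite big_nil.
  by move=> h; have := leq_trans h (size_scale_leq _ _); rewrite size_poly1.
case: s s0 zs {ps pE} => // w s /= /andP[w0 s0] _ _.
rewrite big_cons => h; suff : complex.Im (z - w)^-1 + \sum_(j <- s) complex.Im (z - j)^-1 < 0.
  by rewrite h ltxx.
have im v : complex.Im v <= 0 -> 0 < complex.Im (z - v).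
  by case: (v) (z) z0 => ? ? [? ?] /=; lra.
rewrite ltr_wnDr ?Im_inv_lt0 ?im //.
rewrite big_seq sumr_le0 // => v /(allP s0) v0.
by rewrite ltW // Im_inv_lt0 ?im.
Qed.

Lemma upper_stable_derivn p i : (i < size p)%N -> upper_stable p -> upper_stable p^`(i).
Proof.
move=> + sp; elim: i => // i IH ip; rewrite derivnS.
apply: upper_stable_deriv; last by apply: IH; apply: ltnW.
by rewrite size_derivn ltn_subRL addn1.
Qed.

(** * Polar derivatives and Walsh's theorem *)

Let sqn (w : C) := complex.Re w ^+ 2 + complex.Im w ^+ 2.

Lemma sqn_gt0 w : w != 0 -> 0 < sqn w.
Proof.
case: w => a b; rewrite eq_complex /= negb_and /sqn /=; case/orP => h.
  by rewrite ltr_wpDr ?sqr_ge0 // lt_def sqr_ge0 sqrf_eq0 h.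
by rewrite ltr_wpDl ?sqr_ge0 // lt_def sqr_ge0 sqrf_eq0 h.
Qed.

(** With [w = z - v] and [y = Im z] the right-hand side is Im v / |z - v|^2, so the sign of Im v
    tells whether 1/(z - v) lies in the disk of the points x with y |x|^2 + Im x <= 0. *)
Lemma disk_inv (w : C) (y : R) : w != 0 ->
  y * sqn w^-1 + complex.Im w^-1 = (y - complex.Im w) / sqn w.
Proof.
move=> /sqn_gt0; case: w => a b; rewrite /sqn /= => h.
by field; rewrite gt_eqF.
Qed.

(* The w_i := 1/(z - a_i) lie in the disk Im z |w|^2 + Im w <= 0, while their
   mean W := 1/(z - zeta) would lie outside it; the disk condition is linearised
   at W. *)
Lemma inv_mean_disk (s : seq C) z zeta : 0 < complex.Im z -> 0 < complex.Im zeta ->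
  z != zeta -> (0 < size s)%N -> all (fun w => complex.Im w <= 0) s ->
  \sum_(w <- s) (z - w)^-1 != (size s)%:R * (z - zeta)^-1.
Proof.
move=> z0 zeta0 zz s0 sI; apply/eqP => e.
set y := complex.Im z in z0; set W := (z - zeta)^-1 in e.
(* [phi] is the tangent affine form at [W] of the convex function y |w|^2 + Im w: it minorises that
   function, equals it at [W], and can be summed over the roots. *)
pose phi (w : C) := y * (2 * (complex.Re W * complex.Re w + complex.Im W * complex.Im w)
   - sqn W) + complex.Im w.
have phi_sum (t : seq C) : \sum_(w <- t) phi w =
    y * (2 * (complex.Re W * complex.Re (\sum_(w <- t) w)
            + complex.Im W * complex.Im (\sum_(w <- t) w))
   - (size t)%:R * sqn W) + complex.Im (\sum_(w <- t) w).
  elim: t => [|w t IH]; first by rewrite !big_nil /=; ring.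
  rewrite !big_cons IH /= -add1n natrD /phi.
  by case: w (\sum_(_ <- _) _) => ? ? [? ?] /=; ring.
have phiW : 0 < phi W.
  have -> : phi W = y * sqn W + complex.Im W by rewrite /phi /sqn; ring.
  rewrite disk_inv ?subr_eq0 // divr_gt0 ?sqn_gt0 ?subr_eq0 //.
  by rewrite /y; case: (z) (zeta) zeta0 => ? ? [? ?] /=; lra.
have phi_le w : complex.Im w <= 0 -> phi (z - w)^-1 <= 0.
  move=> w0; have zw : z - w != 0.
    by rewrite subr_eq0; apply/eqP => h; move: w0; rewrite -h leNgt z0.
  have h : y * sqn (z - w)^-1 + complex.Im (z - w)^-1 <= 0.
    rewrite disk_inv // pmulr_lle0 ?invr_gt0 ?sqn_gt0 //.
    by rewrite /y; case: (z) (w) w0 => ? ? [? ?] /=; lra.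
  apply: le_trans h; rewrite /phi lerD2r ler_pM2l // /sqn.
  set a := complex.Re _; set b := complex.Im _; set c := complex.Re _; set d := complex.Im _.
  by have := sqr_ge0 (a - c); have := sqr_ge0 (b - d); nra.
have : \sum_(w <- [seq (z - v)^-1 | v <- s]) phi w <= 0.
  by rewrite big_map big_seq sumr_le0 // => v /(allP sI); exact: phi_le.
rewrite phi_sum big_map size_map e leNgt => /negP; apply.
have -> : complex.Re ((size s)%:R * W) = (size s)%:R * complex.Re W.
  by rewrite !mulr_natl raddfMn.
have -> : complex.Im ((size s)%:R * W) = (size s)%:R * complex.Im W.
  by rewrite !mulr_natl raddfMn.
rewrite [X in 0 < X](_ : _ = (size s)%:R * phi W); last by rewrite /phi; ring.
by rewrite mulr_gt0 // ltr0n.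
Qed.

Definition polar d zeta p := d%:R *: p + (zeta%:P - 'X) * p^`().

(** Laguerre's theorem for a half-plane. At [z != zeta] a zero would make 1/(z - zeta) the mean of
    the 1/(z - w), against [inv_mean_disk]. The coefficient of degree [d] is the leading coefficient
    of [p] times the difference of (d+1) zeta and the sum of the roots, a number of positive
    imaginary part. *)
Lemma upper_stable_polar d p zeta : size p = d.+2 -> upper_stable p ->
  0 < complex.Im zeta ->
  size (polar d.+1 zeta p) = d.+1 /\ upper_stable (polar d.+1 zeta p).
Proof.
move=> sizep sp zeta0; have [s ps s0] := upper_stable_roots sp.
have lp : lead_coef p != 0 by rewrite lead_coef_eq0 -size_poly_eq0 sizep.
have ss : size s = d.+1.
  by have := sizep; rewrite ps size_scale // size_prod_XsubC => -[].
split; last first.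
  move=> z z0; have pz := sp z z0.
  have zs : all (fun w => z != w) s.
    apply/allP => w /(allP s0) w0; apply/eqP => zw; move: z0.
    by rewrite zw ltNge w0.
  have pE : p^`().[z] = p.[z] * \sum_(w <- s) (z - w)^-1.
    by rewrite ps derivZ !hornerZ deriv_prod_XsubC_horner // mulrA.
  rewrite /polar !hornerE pE; have [->|zz] := eqVneq z zeta.
    by rewrite subrr mul0r addr0 mulf_neq0 ?pnatr_eq0 //; exact: sp.
  have sz0 : (0 < size s)%N by rewrite ss.
  have := inv_mean_disk z0 zeta0 zz sz0 s0; rewrite ss => /eqP ne.
  apply/eqP => h; apply: ne; have zz' : z - zeta != 0 by rewrite subr_eq0.
  apply: (mulfI zz'); apply: (mulfI pz).
  rewrite [X in _ = _ * X]mulrCA mulfV // mulr1.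
  have : p.[z] * ((z - zeta) * \sum_(w <- s) (z - w)^-1) = d.+1%:R * p.[z] -
     (d.+1%:R * p.[z] + (zeta - z) * (p.[z] * \sum_(w <- s) (z - w)^-1)) by ring.
  by rewrite h subr0 => ->; rewrite mulrC.
have cE i : (polar d.+1 zeta p)`_i = (d.+1%:R - i%:R) * p`_i + zeta * (i.+1%:R * p`_i.+1).
  rewrite /polar coefD coefZ mulrBl coefB coefCM coefXM.
  by case: i => [|i] /=; rewrite !coef_deriv; ring.
have le : (size (polar d.+1 zeta p) <= d.+1)%N.
  apply/leq_sizeP => i; rewrite leq_eqVlt => /orP[/eqP <-|di]; rewrite cE.
    by rewrite subrr mul0r add0r nth_default ?sizep // !mulr0.
  by rewrite !nth_default ?sizep ?mulr0 ?addr0 //; move: di; lia.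
apply/eqP; rewrite eqn_leq le ltnNge; apply/negP => /leq_sizeP/(_ d (leqnn _)).
rewrite cE -natrB // subSnn mul1r.
have -> : p`_d = - (lead_coef p * \sum_(w <- s) w).
  have := @coefPn_prod_XsubC _ s; rewrite ss => /(_ isT) /= h.
  by rewrite {1}ps coefZ h mulrN.
have -> : p`_d.+1 = lead_coef p by rewrite lead_coefE sizep.
move=> h; have : lead_coef p * (d.+1%:R * zeta - \sum_(w <- s) w) = 0 by rewrite -[RHS]h; ring.
move=> /eqP; rewrite mulf_eq0 (negbTE lp) /= => /eqP /(congr1 (@complex.Im R)).
rewrite raddfB /= Im_sum mulr_natl raddfMn /=.
have : \sum_(w <- s) complex.Im w <= 0 by rewrite big_seq sumr_le0 // => w /(allP s0).
have : 0 < complex.Im zeta *+ d.+1 by rewrite pmulrn_lgt0.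
by lra.
Qed.

(** For [p] of degree at most [d], this is d! times the value of [free_conv d p q] at [x], in a form
    suited to induction on the roots of [q]. *)
Definition taylor_pairing d p q x := \sum_(t < d.+1) (q^`(t)).[0] * (p^`(d - t)).[x].

Lemma derivn_XsubC_mul (b : C) q t :
  (('X - b%:P) * q)^`(t) = ('X - b%:P) * q^`(t) + q^`(t.-1) *+ t.
Proof.
elim: t => [|t IH]; first by rewrite mulr0n addr0.
rewrite derivnS IH derivD derivM derivXsubC mul1r derivMn -!derivnS.
by case: t {IH} => [|t] /=; rewrite ?mulr0n -?derivnS; ring.
Qed.

Lemma derivn_polar d zeta p j : (polar d zeta p)^`(j) =
  d%:R *: p^`(j) + (zeta%:P - 'X) * p^`(j.+1) - p^`(j) *+ j.
Proof.
rewrite /polar -opprB mulNr linearB linearZ /= derivn_XsubC_mul -derivSn.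
rewrite -[p^`()^`(j.-1) *+ j](_ : p^`(j) *+ j = _); first by ring.
by case: j => [|j] /=; rewrite ?mulr0n // -derivSn.
Qed.

(** A root [b] of the second argument is traded for a polar derivative of the first, with a pole
    depending on the evaluation point. *)
Lemma taylor_pairing_polar d p q (b x : C) : (size q <= d.+1)%N ->
  taylor_pairing d.+1 p (('X - b%:P) * q) x =
  taylor_pairing d (polar d.+1 (x - b) p) q x.
Proof.
move=> sq; rewrite /taylor_pairing.
(* Leibniz splits each term: [f] keeps all derivatives on [q], [g] has one derivative spent on the
   linear factor. The last [f] and the first [g] vanish, so shifting [g] by one aligns them. *)
pose f (t : nat) := - b * (q^`(t).[0] * p^`(d.+1 - t).[x]).
pose g (t : nat) := (t%:R * q^`(t.-1).[0]) * p^`(d.+1 - t).[x].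
rewrite (eq_bigr (fun t : 'I_d.+2 => f t + g t)); last first.
  move=> t _; rewrite derivn_XsubC_mul hornerD hornerM hornerMn hornerXsubC sub0r.
  by rewrite /f /g -[_ *+ t]mulr_natl; ring.
rewrite big_split /= big_ord_recr /= [X in _ + X]big_ord_recl /=.
rewrite /f [q^`(d.+1)]derivn_poly0 // horner0 mul0r mulr0 addr0.
rewrite /g mul0r mul0r add0r -big_split /=; apply: eq_bigr => t _.
rewrite /bump /= add1n subSS (subSn (leq_ord t)) derivn_polar.
rewrite !hornerE hornerMn -[_ *+ (d - t)]mulr_natl (natrB _ (leq_ord t)) -!natr1.
by rewrite /=; ring.
Qed.

(** Induction on the roots of the second polynomial: since [Im b <= 0 < Im x], each pole [x - b]
    lies in the upper half-plane and [upper_stable_polar] applies. *)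
Lemma taylor_pairing_neq0 d p (s : seq C) x : size p = d.+1 -> upper_stable p ->
  size s = d -> all (fun w => complex.Im w <= 0) s -> 0 < complex.Im x ->
  taylor_pairing d p (\prod_(w <- s) ('X - w%:P)) x != 0.
Proof.
elim: d p s => [|d IH] p [|b s] // sizep sp.
  move=> _ _ x0; rewrite /taylor_pairing big_ord_recl big_ord0 /= addr0 big_nil.
  by rewrite hornerC mul1r; exact: sp.
move=> [ss] /andP[b0 s0] x0; rewrite big_cons taylor_pairing_polar; last first.
  by rewrite size_prod_XsubC ss.
have xb : 0 < complex.Im (x - b) by case: (x) (b) x0 b0 => ? ? [? ?] /=; lra.
have [sz st] := upper_stable_polar sizep sp xb.
exact: IH.
Qed.

Lemma upper_stable_free_conv d p q : size p = d.+1 -> size q = d.+1 ->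
  upper_stable p -> upper_stable q -> upper_stable (free_conv d p q).
Proof.
move=> sizep sizeq sp sq x x0; have [s qs s0] := upper_stable_roots sq.
have lq : lead_coef q != 0 by rewrite lead_coef_eq0 -size_poly_eq0 sizeq.
have ss : size s = d.
  by have := sizeq; rewrite qs size_scale // size_prod_XsubC => -[].
have : (d`!%:R *: free_conv d p q).[x] != 0.
  rewrite free_convE ?sizep // horner_sum.
  have := taylor_pairing_neq0 sizep sp ss s0 x0.
  rewrite -(mulrI_eq0 _ (mulfI lq)) /taylor_pairing mulr_sumr.
  congr (_ != _); apply: eq_bigr => t _.
  by rewrite {2}qs !linearZ /= !hornerZ mulrA.
by rewrite hornerZ mulf_eq0 negb_or => /andP[].
Qed.

Lemma upper_stable_real_root (P : {poly R}) (w : C) :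
  upper_stable (map_poly (real_complex R) P) -> root (map_poly (real_complex R) P) w ->
  complex.Im w = 0.
Proof.
move=> sP rw; have rw' : root (map_poly (real_complex R) P) w^*%C.
  rewrite -complex_root_conj -map_poly_comp.
  rewrite [X in root X _](_ : _ = map_poly (real_complex R) P) //.
  by apply: eq_map_poly => a /=; rewrite oppr0.
apply/eqP; rewrite eq_le !leNgt; apply/andP; split; apply/negP => h.
  by have := sP _ h; rewrite -rootE rw.
have h' : 0 < complex.Im w^*%C by case: (w) h => a b /=; rewrite oppr_gt0.
by have := sP _ h'; rewrite -rootE rw'.
Qed.

Lemma upper_stable_prod_real (I : finType) (A : pred I) (f : I -> R) :
  upper_stable (map_poly (real_complex R) (\prod_(i in A) ('X - (f i)%:P))).
Proof.
move=> z z0; rewrite rmorph_prod horner_prod; apply/prodf_neq0 => i _.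
rewrite /= map_polyXsubC hornerXsubC subr_eq0; apply/eqP => h; move: z0.
by rewrite h /= ltxx.
Qed.

End Walsh.

(** * Continuity of roots *)

Section RootContinuity.
Variables (K : numFieldType) (T : Type) (F : set_system T).
Context {FF : Filter F}.

Lemma cvg_sum (I : Type) (r : seq I) (f : I -> T -> K) (a : I -> K) :
  (forall i, f i @ F --> a i) ->
  (fun e => \sum_(i <- r) f i e) @ F --> \sum_(i <- r) a i.
Proof.
move=> fa; elim: r => [|i r IH].
  by under eq_fun do rewrite big_nil; rewrite big_nil; exact: cvg_cst.
by under eq_fun do rewrite big_cons; rewrite big_cons; exact: cvgD.
Qed.

Lemma exprn_lt_prod (s : seq K) (f : K -> K) c : (0 < size s)%N -> 0 <= c ->
  (forall w, w \in s -> c < f w) -> c ^+ size s < \prod_(w <- s) f w.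
Proof.
move=> + c0; elim: s => // w [|w' s] IH _ cf.
  by rewrite big_seq1 expr1; apply: cf; rewrite mem_head.
rewrite big_cons exprS ltr_pM ?exprn_ge0 //; first by apply: cf; rewrite mem_head.
by apply: IH => // v vs; apply: cf; rewrite in_cons vs orbT.
Qed.

(** The product of the distances is |P(z)|, so the distances cannot all exceed its geometric
    mean. *)
Lemma exists_small_factor (s : seq K) (z : K) : (0 < size s)%N ->
  exists2 w, w \in s & `|z - w| ^+ size s <= `|(\prod_(w <- s) ('X - w%:P)).[z]|.
Proof.
move=> s0; apply: contrapT => no.
set P := `|_| in no.
have hlt w : w \in s -> P < `|z - w| ^+ size s.
  move=> ws; rewrite real_ltNge ?normr_real ?rpredX ?normr_real //.
  by apply/negP => h; apply: no; exists w.
have := exprn_lt_prod s0 (normr_ge0 _) hlt.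
have e1 : \prod_(w <- s) (z - w) = (\prod_(w <- s) ('X - w%:P)).[z].
  by rewrite horner_prod; apply: eq_bigr => w _; rewrite hornerXsubC.
by rewrite prodrXl -normr_prod e1 ltxx.
Qed.

(* Top-down: the coefficients of a quotient by a monic factor are determined by
   those of the product. *)
Lemma cvg_coef_quotient_XsubC (n : nat) (p : T -> {poly K}) (p0 : {poly K})
    (w : T -> K) (w0 : K) i :
  (forall e, (size (p e) <= n)%N) -> (size p0 <= n)%N -> w @ F --> w0 ->
  (forall i, (fun e => (('X - (w e)%:P) * p e)`_i) @ F --> (('X - w0%:P) * p0)`_i) ->
  (fun e => (p e)`_i) @ F --> p0`_i.
Proof.
move=> sp sp0 ww cv.
(* Downward induction on [i], carried by [k] with [n <= i + k]; from index [n] on all coefficients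
   are zero. *)
have [k ik] : exists k, (n <= i + k)%N by exists n; exact: leq_addl.
elim: k i ik => [|k IH] i ik.
  rewrite addn0 in ik; under eq_fun do rewrite nth_default ?(leq_trans (sp _)) //.
  by rewrite nth_default ?(leq_trans sp0) //; exact: cvg_cst.
have E (c : K) (q : {poly K}) : q`_i = (('X - c%:P) * q)`_i.+1 + c * q`_i.+1.
  by rewrite mulrBl coefB coefXM coefCM /= subrK.
rewrite (E w0); under eq_fun => e do rewrite (E (w e)).
by apply: cvgD; [exact: cv | apply: cvgM => //; apply: IH; rewrite addSnnS].
Qed.

(** The labelling is chosen at each [e] independently, and only its limit along [F] is controlled;
    with a general filter, full and punctured neighbourhoods are both covered. *)
Theorem root_continuity (t : seq K) (s : T -> seq K) :
  (forall e, size (s e) = size t) ->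
  (forall i, (fun e => (\prod_(w <- s e) ('X - w%:P))`_i) @ F -->
     (\prod_(w <- t) ('X - w%:P))`_i) ->
  exists s' : nat -> T -> K,
    (forall e, perm_eq (s e) [seq s' i e | i <- iota 0 (size t)]) /\
    (forall i, (i < size t)%N -> s' i @ F --> t`_i).
Proof.
elim: t s => [|z t IH] s ss cv.
  exists (fun _ _ => 0); split => // e.
  by have := ss e; case: (s e).
have s0 e : (0 < size (s e))%N by rewrite ss.
have /choice[w /all_and2[ws wle]] : forall e, exists w, w \in s e /\
    `|z - w| ^+ size (s e) <= `|(\prod_(w <- s e) ('X - w%:P)).[z]|.
  by move=> e; have [w ws wle] := exists_small_factor z (s0 e); exists w.
have pz : (fun e => (\prod_(w <- s e) ('X - w%:P)).[z]) @ F --> (0 : K).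
  rewrite [X in _ --> X](_ : _ = (\prod_(w <- z :: t) ('X - w%:P)).[z]); last first.
    by rewrite big_cons hornerM hornerXsubC subrr mul0r.
  have hE (r : seq K) : size r = (size t).+1 -> (\prod_(w <- r) ('X - w%:P)).[z] =
      \sum_(i < (size t).+2) (\prod_(w <- r) ('X - w%:P))`_i * z ^+ i.
    by move=> sr; rewrite horner_coef size_prod_XsubC sr.
  rewrite hE //; under eq_fun do rewrite hE //.
  by apply: cvg_sum => i; apply: cvgMr_tmp; exact: cv.
have wz : w @ F --> z.
  apply/cvgrPdist_lt => eps eps0.
  have epsn : 0 < eps ^+ (size t).+1 by rewrite exprn_gt0.
  have /cvgrPdist_lt/(_ _ epsn) := pz.
  apply: filterS => e; rewrite sub0r normrN => pe.
  rewrite -(@ltr_pXn2r _ (size t).+1) ?nnegrE ?normr_ge0 ?ltW //.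
  by apply: le_lt_trans pe; have := wle e; rewrite ss.
have [] := IH (fun e => rem (w e) (s e)).
- by move=> e; rewrite size_rem // ss.
- move=> i; apply: (@cvg_coef_quotient_XsubC (size t).+1 _ _ w z) => //.
  + by move=> e; rewrite size_prod_XsubC size_rem // ss.
  + by rewrite size_prod_XsubC.
  + move=> j; move: (cv j); rewrite big_cons; apply: cvg_trans; apply: near_eq_cvg.
    apply: nearW => e /=; rewrite (perm_big _ (perm_to_rem (ws e))) /= big_cons //.
move=> s' [perm' cv'].
exists (fun i => if i is i'.+1 then s' i' else w); split.
  move=> e /=; rewrite (permPl (perm_to_rem (ws e))) perm_cons.
  by rewrite (permPl (perm' e)) -[1%N]addn0 iotaDl -map_comp.
by case.
Qed.

End RootContinuity.

(** * Analytic branches through simple roots *)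

Section AnalyticRoot.
Variable R : realType.
Implicit Types (p q Z Y : {poly R}) (G H : {poly {poly R}}).

(** The weighted l^1 norm, the sum of the |p_i| r^i, as a value of the polynomial of absolute
    coefficients. *)
Definition wnorm (r : R) p := (map_poly Num.norm p).[r].

Lemma coef_absp p i : (map_poly Num.norm p)`_i = `|p`_i|.
Proof. by rewrite coef_map_id0 // normr0. Qed.

Lemma horner_widen n p x : (size p <= n)%N -> p.[x] = \sum_(i < n) p`_i * x ^+ i.
Proof.
move=> pn; rewrite horner_coef (big_ord_widen _ (fun i => p`_i * x ^+ i) pn) big_mkcond.
by apply: eq_bigr => i _; case: ltnP => // h; rewrite nth_default // mul0r.
Qed.

Lemma ler_horner_coef p q x : 0 <= x -> (forall i, p`_i <= q`_i) -> p.[x] <= q.[x].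
Proof.
move=> x0 pq; rewrite (horner_widen x (leq_maxl (size p) (size q))).
rewrite (horner_widen x (leq_maxr (size p) (size q))).
by apply: ler_sum => i _; rewrite ler_wpM2r // exprn_ge0.
Qed.

Lemma wnorm_ge0 r p : 0 <= r -> 0 <= wnorm r p.
Proof.
move=> r0; rewrite /wnorm -[leLHS](horner0 r); apply: ler_horner_coef => // i.
by rewrite coef0 coef_absp.
Qed.

Lemma wnormD r p q : 0 <= r -> wnorm r (p + q) <= wnorm r p + wnorm r q.
Proof.
move=> r0; rewrite /wnorm -hornerD; apply: ler_horner_coef => // i.
by rewrite coefD !coef_absp coefD ler_normD.
Qed.

Lemma wnormM r p q : 0 <= r -> wnorm r (p * q) <= wnorm r p * wnorm r q.
Proof.
move=> r0; rewrite /wnorm -hornerM; apply: ler_horner_coef => // i.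
rewrite coef_absp !coefM (le_trans (ler_norm_sum _ _ _)) //.
by apply: ler_sum => j _; rewrite !coef_absp normrM.
Qed.

Lemma coef_wnorm r p i : 0 <= r -> `|p`_i| * r ^+ i <= wnorm r p.
Proof.
move=> r0; have -> : `|p`_i| * r ^+ i = (`|p`_i| *: 'X^i).[r] by rewrite !hornerE ?hornerXn.
apply: ler_horner_coef => // j; rewrite coefZ coefXn coef_absp.
by case: eqP => [->|_]; rewrite ?mulr1 ?mulr0.
Qed.

(** A Schwarz-type estimate: each surviving term has exponent i >= N, and (|y|/r)^i <= (|y|/r)^N as
    |y| <= r. *)
Lemma horner_wnorm r p y N : 0 < r -> `|y| <= r -> (forall i, (i < N)%N -> p`_i = 0) ->
  `|p.[y]| <= (`|y| / r) ^+ N * wnorm r p.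
Proof.
move=> r0 yr p0; rewrite /wnorm (@horner_widen (size p)) // (@horner_widen (size p) _ r); last first.
  by rewrite size_poly.
rewrite (le_trans (ler_norm_sum _ _ _)) // mulr_sumr; apply: ler_sum => i _.
rewrite normrM normrX coef_absp.
have [iN|Ni] := ltnP i N; first by rewrite p0 // normr0 !mul0r mulr0.
have -> : `|y| ^+ i = (`|y| / r) ^+ i * r ^+ i by rewrite -exprMn divfK // gt_eqF.
rewrite [leLHS]mulrCA ler_wpM2r ?mulr_ge0 ?exprn_ge0 ?(ltW r0) //.
by rewrite ler_wiXn2l // ?divr_ge0 ?(ltW r0) // ler_pdivrMr // mul1r.
Qed.

Lemma wnorm_small r p : 0 <= r -> r <= 1 -> p`_0 = 0 -> wnorm r p <= r * wnorm 1 p.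
Proof.
move=> r0 r1 p0; rewrite /wnorm !(@horner_widen (size p)) ?size_poly // mulr_sumr.
apply: ler_sum => i _; rewrite coef_absp expr1n mulr1.
case: (nat_of_ord i) => [|j]; first by rewrite p0 normr0 mul0r mulr0.
rewrite mulrC ler_wpM2r // exprS ler_piMr // exprn_ile1 //.
Qed.

Lemma wnorm_le r s p : 0 <= r -> r <= s -> wnorm r p <= wnorm s p.
Proof.
move=> r0 rs; rewrite /wnorm !(@horner_widen (size p)) ?size_poly //.
apply: ler_sum => i _; rewrite coef_absp ler_wpM2l // lerXn2r ?nnegrE //.
exact: le_trans rs.
Qed.

Lemma horner2_sub G Z Y : exists E, G.[Z] - G.[Y] = (Z - Y) * E.
Proof.
elim/poly_ind: G => [|G c [E IH]]; first by exists 0; rewrite !horner0 subrr mulr0.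
exists (E * Z + G.[Y]); rewrite !hornerMXaddC.
have -> : G.[Z] = G.[Y] + (Z - Y) * E by rewrite -IH; ring.
by ring.
Qed.

Lemma coef0_factorX p : p`_0 = 0 -> exists q, p = 'X * q.
Proof.
elim/poly_ind: p => [|p c _]; first by exists 0; rewrite mulr0.
rewrite coefD coefMX coefC /= add0r => ->.
by exists p; rewrite addr0 mulrC.
Qed.

(** This makes evaluation of [G] a contraction for the X-adic topology: agreement of two arguments
    improves by one order. The linear coefficient of [G] and both arguments vanish at 0, which
    forces the difference quotient to be divisible by ['X]. *)
Lemma horner2_sub_factorX G Z Y : Z`_0 = 0 -> Y`_0 = 0 -> G`_1`_0 = 0 ->
  exists E, G.[Z] - G.[Y] = (Z - Y) * ('X * E).
Proof.
move=> Z0 Y0; elim/poly_ind: G => [|G c _] G0.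
  by exists 0; rewrite !horner0 subrr !mulr0.
have {}G0 : G`_0`_0 = 0 by move: G0; rewrite coefD coefMX coefC addr0.
have [E eE] := horner2_sub G Z Y; have [E' eE'] := horner2_sub G Y 0.
have [E2 eE2] : exists E2, E * Z + G.[Y] = 'X * E2.
  apply: coef0_factorX; rewrite -(subrK G.[0] G.[Y]) eE' subr0 horner_coef0.
  by rewrite !coefD !coef0M Z0 Y0 G0 mulr0 mul0r !addr0.
exists E2; rewrite -eE2 !hornerMXaddC.
have -> : G.[Z] = G.[Y] + (Z - Y) * E by rewrite -eE; ring.
by ring.
Qed.

Lemma cvg_horner2 (F : set_system nat) (FF : Filter F) G (u : nat -> R) (l y : R) :
  u @ F --> l -> (fun N => G.[(u N)%:P].[y]) @ F --> G.[l%:P].[y].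
Proof.
move=> ul; elim/poly_ind: G => [|G c IH].
  by under eq_fun do rewrite !horner0; rewrite !horner0; exact: cvg_cst.
under eq_fun do rewrite hornerMXaddC hornerD hornerM hornerC.
rewrite hornerMXaddC hornerD hornerM hornerC.
by apply: cvgD; [exact: cvgM | exact: cvg_cst].
Qed.

Lemma horner2E G Z y : G.[Z].[y] = G.[(Z.[y])%:P].[y].
Proof.
elim/poly_ind: G => [|G c IH]; first by rewrite !horner0.
by rewrite !hornerMXaddC !hornerE IH.
Qed.

Lemma wnorm_horner2 r t G Z : 0 <= r -> wnorm r Z <= t ->
  wnorm r G.[Z] <= \sum_(i < size G) wnorm r G`_i * t ^+ i.
Proof.
move=> r0 Zt; have t0 : 0 <= t := le_trans (wnorm_ge0 _ r0) Zt.
have wX i : wnorm r (Z ^+ i) <= t ^+ i.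
  elim: i => [|i IH].
    by rewrite !expr0 /wnorm (_ : map_poly _ _ = 1) ?hornerC //; apply/polyP => i; rewrite coef_absp coef1; case: eqP; rewrite ?normr1 ?normr0.
  by rewrite !exprS (le_trans (wnormM _ _ r0)) // ler_pM ?wnorm_ge0.
rewrite horner_coef; elim/big_ind2: _ => [|p x q y px qy|i _].
- by rewrite /wnorm map_poly0 horner0.
- by rewrite (le_trans (wnormD _ _ r0)) // lerD.
- by rewrite (le_trans (wnormM _ _ r0)) // ler_wpM2l ?wnorm_ge0.
Qed.

(** * Convergence of the fixed-point iteration *)

Section Iteration.
Variable G : {poly {poly R}}.
Hypotheses (G00 : G`_0`_0 = 0) (G10 : G`_1`_0 = 0).

(** The ball of radius [tau] for [wnorm r] is to contain all iterates. With [r = tau ^+ 2] every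
    term of [G] contributes at most its norm at radius 1 times [r], hence a total of at most
    [M * r = M * tau * tau <= tau]. *)
Let M := \sum_(i < size G) wnorm 1 G`_i.
Let tau := (2 * (M + 1))^-1.
Let r := tau ^+ 2.

Let M_ge0 : 0 <= M.
Proof. by apply: sumr_ge0 => i _; apply: wnorm_ge0. Qed.

Let tau_gt0 : 0 < tau.
Proof. by rewrite invr_gt0; have := M_ge0; lra. Qed.

Let tau_le1 : tau <= 1.
Proof. by rewrite invf_le1; have := M_ge0; lra. Qed.

Let r_gt0 : 0 < r. Proof. exact: exprn_gt0. Qed.

Let r_le1 : r <= 1. Proof. by rewrite exprn_ile1 // ltW. Qed.

Let Z N := iter N (horner G) 0.

Lemma wnorm_iterate N : wnorm r (Z N) <= tau.
Proof.
elim: N => [|N IH]; first by rewrite /wnorm map_poly0 horner0 ltW.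
rewrite /Z iterS (le_trans (wnorm_horner2 _ (ltW r_gt0) IH)) //.
have h0 i : 0 <= wnorm 1 G`_i by apply: wnorm_ge0.
apply: (@le_trans _ _ (\sum_(i < size G) wnorm 1 G`_i * r)).
  (* For [i = 0] and [i = 1] the factor [r] comes from the vanishing constant coefficient of the
     i-th coefficient of [G]; for [i >= 2] it comes from tau^i <= tau^2. *)
  apply: ler_sum => i _; case: (nat_of_ord i) => [|[|j]].
  - rewrite expr0 mulr1 (le_trans (wnorm_small _ _ G00)) ?(ltW r_gt0) //.
    by rewrite mulrC.
  - rewrite expr1 (@le_trans _ _ (wnorm r G`_1)) //.
      by rewrite ler_piMr // wnorm_ge0 // ltW.
    rewrite (le_trans (wnorm_small _ _ G10)) ?(ltW r_gt0) //.
    by rewrite mulrC.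
  - rewrite ler_pM ?wnorm_ge0 ?exprn_ge0 ?wnorm_le ?(ltW tau_gt0) ?(ltW r_gt0) //.
    by rewrite /r -[j.+2]addn2 exprD ler_piMl ?exprn_ge0 ?exprn_ile1 ?(ltW tau_gt0).
rewrite -mulr_suml -/M /r expr2 mulrA ler_piMl ?(ltW tau_gt0) //.
rewrite /tau ler_pdivrMr; by have := M_ge0; lra.
Qed.

Let iterate0 N : (Z N)`_0 = 0.
Proof.
elim: N => [|N IH]; first by rewrite coef0.
have [E] := horner2_sub G (Z N) 0.
move=> /(congr1 (coefp 0)) /=; rewrite coefB coef0M horner_coef0 G00 !subr0 IH mul0r.
by [].
Qed.

Let iterate_step N : exists D, Z N.+1 - Z N = 'X^(N.+1) * D.
Proof.
elim: N => [|N [D IH]].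
  by rewrite expr1 subr0; apply: coef0_factorX; exact: iterate0.
have [E e] := horner2_sub_factorX (iterate0 N.+1) (iterate0 N) G10.
exists (D * E); have -> : Z N.+2 - Z N.+1 = (Z N.+1 - Z N) * ('X * E) by rewrite -e.
by rewrite IH [in RHS]exprS; ring.
Qed.

Let iterate_coef N i : (i <= N)%N -> (Z N)`_i = (Z i)`_i.
Proof.
elim: N => [|N IH]; first by rewrite leqn0 => /eqP ->.
rewrite leq_eqVlt => /orP[/eqP -> //|iN]; rewrite -IH //.
have [D e] := iterate_step N; have -> : Z N.+1 = Z N + 'X^(N.+1) * D by rewrite -e; ring.
by rewrite coefD coefXnM iN addr0.
Qed.

(** The k-th coefficient is frozen from step [k] on, so the diagonal is the power series of the
    formal fixed point. *)
Let a (k : nat) : R := (Z k)`_k.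

Lemma analytic_fixpoint : exists (c : R^nat) (rho K : R), [/\ 0 < rho, 0 <= K, c 0%N = 0 &
  forall y, `|y| < rho -> exists l : R, [/\ pseries c y @ \oo --> l,
     G.[l%:P].[y] = l & `|l| <= K * `|y|]].
Proof.
(* The bound |a_k| r^k <= tau gives convergence for |y| < r; [tau / r] is the constant that
   [horner_wnorm] yields with [N = 1]. *)
exists a, r, (tau / r); split => //.
- by apply: divr_ge0; apply: ltW.
- exact: coef0.
move=> y yr; set theta := `|y| / r.
have th0 : 0 <= theta by apply: divr_ge0 => //; apply: ltW.
have th1 : theta < 1 by rewrite /theta ltr_pdivrMr // mul1r.
have thn : `|theta| < 1 by rewrite ger0_norm.
have : cvgn (pseries a y).
  apply: normed_cvg; apply: (@series_le_cvg _ _ (fun k => tau * theta ^+ k)).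
  - by move=> k; exact: normr_ge0.
  - by move=> k; rewrite mulr_ge0 ?exprn_ge0 ?(ltW tau_gt0).
  - move=> k /=; rewrite normrM normrX /theta expr_div_n mulrA ler_pdivlMr ?exprn_gt0 //.
    rewrite mulrAC ler_wpM2r ?exprn_ge0 //.
    exact: le_trans (coef_wnorm _ _ (ltW r_gt0)) (wnorm_iterate k).
  - exact: is_cvg_geometric_series.
move=> /cvg_ex[l al]; exists l.
have geo : (fun N => theta ^+ N * tau) @ \oo --> (0 : R).
  by rewrite -[X in _ --> X](mul0r tau); apply: cvgMr_tmp; exact: cvg_expr.
have Zl : (fun N => (Z N).[y]) @ \oo --> l.
  have al' : (fun N => pseries a y N.+1) @ \oo --> l by rewrite (cvg_shiftS (pseries a y)).
  rewrite -[X in _ --> X]add0r.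
  (* The iterate and the partial sum agree up to degree [N], so they differ by at most
     [theta ^+ N * tau] and share their limit. *)
  rewrite [X in X @ _ --> _](_ : _ = (fun N => ((Z N).[y] - pseries a y N.+1)
     + pseries a y N.+1)); last by apply/funext => N; rewrite subrK.
  apply: cvgD => //; apply/norm_cvg0P.
  apply: (squeeze_cvgr _ (cvg_cst 0) geo); apply: nearW => N; rewrite normr_ge0 /=.
  pose P := \poly_(i < N.+1) a i.
  have PE : P.[y] = pseries a y N.+1.
    by rewrite horner_poly /pseries /series /= big_mkord.
  have dE i : (Z N - P)`_i = if (i < N.+1)%N then 0 else (Z N)`_i.
    rewrite coefB coef_poly; case: ltnP => iN; last by rewrite subr0.
    by rewrite iterate_coef // subrr.
  rewrite -PE -hornerN -hornerD.
  have := @horner_wnorm r (Z N - P) y N.+1 r_gt0 (ltW yr).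
  have d0 i : (i < N.+1)%N -> (Z N - P)`_i = 0 by move=> iN; rewrite dE iN.
  move=> /(_ d0) /le_trans; apply; apply: ler_pM; rewrite ?exprn_ge0 ?wnorm_ge0 ?(ltW r_gt0) //.
    by rewrite exprS ler_piMl ?exprn_ge0 // ltW.
  apply: le_trans (wnorm_iterate N); apply: ler_horner_coef; first exact: ltW.
  by move=> i; rewrite !coef_absp dE; case: ifP => // _; rewrite normr0.
split => //.
- have Zl' : (fun N => (Z N.+1).[y]) @ \oo --> l by rewrite (cvg_shiftS (fun N => (Z N).[y])).
  apply: (@cvg_unique _ _ ((fun N => (Z N.+1).[y]) @ \oo)) => //.
  have -> : (fun N => (Z N.+1).[y]) = (fun N => G.[((Z N).[y])%:P].[y]).
    by apply/funext => N; rewrite /Z iterS horner2E.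
  exact: cvg_horner2.
- rewrite -(cvg_lim _ (cvg_norm Zl)) //; apply: limr_le.
    by apply/cvg_ex; exists `|l|; exact: cvg_norm.
  apply: nearW => N.
  rewrite (le_trans (@horner_wnorm r _ y 1 r_gt0 (ltW yr) _)) //.
    by move=> i; rewrite ltnS leqn0 => /eqP ->.
  rewrite expr1 [leLHS]mulrC mulrAC -mulrA ler_wpM2r //.
  exact: wnorm_iterate.
Qed.

End Iteration.

(* Newton's map z |-> z - H(lambda + z, y) / H_z(lambda, 0) satisfies the hypotheses
   of [analytic_fixpoint]. *)
Lemma analytic_root H lambda : H.[lambda%:P].[0] = 0 -> H^`().[lambda%:P].[0] != 0 ->
  exists (c : R^nat) (rho K : R), [/\ 0 < rho, 0 <= K, c 0%N = lambda &
  forall y, `|y| < rho -> exists l : R, [/\ pseries c y @ \oo --> l,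
     H.[l%:P].[y] = 0 & `|l - lambda| <= K * `|y|]].
Proof.
move=> H0; set d := H^`().[lambda%:P].[0] => d0.
pose G : {poly {poly R}} := 'X - (d^-1)%:P%:P * (H \Po ('X + lambda%:P%:P)).
have GE x y : G.[x%:P].[y] = x - d^-1 * H.[(x + lambda)%:P].[y].
  by rewrite /G !hornerE horner_comp !hornerE polyCD.
have [] := @analytic_fixpoint G.
- have -> : G`_0`_0 = G.[0%:P].[0] by rewrite polyC0 !horner_coef0.
  by rewrite GE !add0r H0 mulr0 oppr0.
- have -> : G`_1 = G^`().[0] by rewrite horner_coef0 coef_deriv mulr1n.
  rewrite /G derivB derivX derivM derivC mul0r add0r deriv_comp derivD derivX derivC addr0 mulr1.
  rewrite -horner_coef0 !hornerE horner_comp !hornerE -/d.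
  by rewrite mulVf // subrr.
move=> c [rho [K [rho0 K0 c0 cl]]].
exists (fun k => if k is 0 then lambda else c k), rho, K; split => // y /cl[l [l1 l2 l3]].
exists (l + lambda); split; last by rewrite addrK.
- rewrite -(cvg_shiftS (pseries _ y)).
  rewrite [X in X @ _ --> _](_ : _ = (fun N => pseries c y N.+1 + lambda)); last first.
    apply/funext => N; rewrite /pseries /series /= !big_nat_recl // c0 !expr0 mul0r add0r mulr1.
    by rewrite addrC.
  apply: cvgD; last exact: cvg_cst.
  by rewrite (cvg_shiftS (pseries c y)).
- move: l2; rewrite GE => /eqP; rewrite subr_eq addrC -subr_eq subrr eq_sym.
  by rewrite mulf_eq0 invr_eq0 (negbTE d0) => /eqP.
Qed.

End AnalyticRoot.

(** * The root cluster *)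

Section Helpers.
Variables (K : numFieldType) (T : Type) (F : set_system T).
Context {FF : Filter F}.

Lemma comp_poly_scaleX (p : {poly K}) (e : K) i : (p \Po (e *: 'X))`_i = e ^+ i * p`_i.
Proof.
rewrite comp_polyE coef_sum.
under eq_bigr do rewrite exprZn scalerA coefZ coefXn.
have [ip|pi] := ltnP i (size p).
  rewrite (bigD1 (Ordinal ip)) //= eqxx mulr1 big1 ?addr0; first by rewrite mulrC.
  by move=> j; rewrite -val_eqE /= eq_sym => /negbTE ->; rewrite mulr0.
rewrite [p`_i]nth_default // mulr0 big1 // => j _.
by rewrite gtn_eqF ?mulr0 // (leq_trans _ pi).
Qed.

Lemma cvg_coef_comp_poly n (p : T -> {poly K}) (p0 q : {poly K}) i :
  (forall e, (size (p e) <= n)%N) -> (size p0 <= n)%N ->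
  (forall j, (fun e => (p e)`_j) @ F --> p0`_j) ->
  (fun e => (p e \Po q)`_i) @ F --> (p0 \Po q)`_i.
Proof.
move=> sp sp0 pp.
have cE (r : {poly K}) : (size r <= n)%N ->
    (r \Po q)`_i = \sum_(j < n) r`_j * (q ^+ j)`_i.
  move=> rn; rewrite comp_polyE coef_sum.
  rewrite (big_ord_widen _ (fun j => (r`_j *: q ^+ j)`_i) rn) big_mkcond.
  by apply: eq_bigr => j _; case: ltnP => [_|rj]; rewrite ?coefZ // nth_default ?mul0r.
rewrite cE //; under eq_fun do rewrite cE //.
by apply: cvg_sum => j; apply: cvgMr_tmp.
Qed.

(* Bottom-up: the coefficients of N are determined by those of N * G as long as
   the constant coefficient of G stays away from 0. *)
Lemma cvg_coef_quotient_unit (P N G : T -> {poly K}) (P0 : {poly K}) (g0 : K) i :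
  g0 != 0 -> (\forall e \near F, P e = N e * G e) ->
  (forall i, (fun e => (P e)`_i) @ F --> P0`_i) ->
  (forall i, (fun e => (G e)`_i) @ F --> (g0%:P)`_i) ->
  (fun e => (N e)`_i) @ F --> P0`_i / g0.
Proof.
move=> g00 PE cP cG; elim/ltn_ind: i => i IH.
have cG0 : (fun e => (G e)`_0) @ F --> g0 by have := cG 0%N; rewrite coefC.
have G0 : \forall e \near F, (G e)`_0 != 0 by exact: (cvgr_neq0 g0 cG0 g00).
have c1 : (fun e => (P e)`_i - \sum_(j < i) (N e)`_j * (G e)`_(i - j)) @ F --> P0`_i.
  rewrite -[X in _ --> X]subr0; apply: cvgB; first exact: cP.
  rewrite [X in _ --> X](_ : _ = \sum_(j < i) P0`_j / g0 * (g0%:P)`_(i - j)).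
    by apply: cvg_sum => j; apply: cvgM; [exact: IH | exact: cG].
  rewrite big1 // => j _; rewrite coefC subn_eq0 leqNgt ltn_ord mulr0 //.
refine (cvg_trans _ (cvgM c1 (cvgV g00 cG0))); apply: near_eq_cvg.
near=> e.
have Ge : (G e)`_0 != 0 by near: e.
have Pe : P e = N e * G e by near: e.
rewrite /= Pe coefM big_ord_recr /= subnn /=.
by rewrite [X in X - _]addrC addrK mulfK.
Unshelve. all: by end_near.
Qed.

(** This governs the rescaled far factor: the coefficients [a e] of ['X] tend to 0 and only the
    product of the constants remains. *)
Lemma cvg_coef_prod_scaled (l : seq nat) (a : T -> K) (s : nat -> T -> K) (t : nat -> K) i :
  a @ F --> (0 : K) -> (forall j, j \in l -> s j @ F --> t j) ->
  (fun e => (\prod_(j <- l) (a e *: 'X - (s j e)%:P))`_i) @ F -->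
  ((\prod_(j <- l) - t j)%:P)`_i.
Proof.
move=> a0; elim: l i => [|j l IH] i st.
  by under eq_fun do rewrite big_nil; rewrite big_nil; exact: cvg_cst.
have {}IH i' := IH i' (fun j' jl => st j' (mem_behead (s := j :: l) jl)).
under eq_fun do rewrite big_cons mulrBl -scalerAl coefB coefZ coefXM coefCM.
rewrite big_cons polyCM coefCM mulNr -sub0r.
apply: cvgB; last by apply: cvgM; [apply: st; rewrite mem_head | exact: IH].
case: (i == 0)%N; first by have /(_ FF) := cvgMr_tmp (b := 0) a0; rewrite mul0r.
by have /(_ FF) := cvgM a0 (IH i.-1); rewrite mul0r.
Qed.

End Helpers.

Section Complex.
Variable R : realType.
Let K : numFieldType := R[i].

(** In the partial order of [R[i]] positive numbers are real, so complex epsilons reduce to real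
    ones. *)
Lemma gtc0_real (e : R[i]) : 0 < e -> exists2 e1 : R, 0 < e1 & e = e1%:C%C.
Proof.
case: e => a b; rewrite ltcE /= => /andP[/eqP -> a0]; by exists a.
Qed.

Lemma normc_real (x : R) : `|x%:C%C| = `|x|%:C%C.
Proof. by rewrite normc_def /= expr0n /= addr0 sqrtr_sqr. Qed.

Lemma cvg_real_complex (T : Type) (F : set_system T) {FF : Filter F} (f : T -> R) (l : R) :
  f @ F --> l -> (fun e => (f e)%:C%C : K) @ F --> (l%:C%C : K).
Proof.
move=> fl; apply/cvgrPdist_lt => _ /gtc0_real[e e0 ->].
have /cvgrPdist_lt/(_ _ e0) := fl; apply: filterS => x.
by rewrite -rmorphB normc_real ltcR.
Qed.

Lemma croots_prod (p : {poly R}) : p \is monic ->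
  cpoly p = \prod_(w <- croots p) ('X - w%:P).
Proof.
move=> pm; rewrite /croots; case: closed_field_poly_normal => s /= ps.
by rewrite {1}ps lead_coef_map (monicP pm) rmorph1 scale1r.
Qed.

Lemma size_croots (p : {poly R}) : p \is monic -> size (croots p) = (size p).-1.
Proof.
move=> pm; have := size_prod_XsubC (croots p) id; rewrite -croots_prod //.
by rewrite size_map_poly => ->.
Qed.

Lemma mset_cvg_componentwise (T : Type) (F : set_system T) {FF : Filter F}
    (s : T -> seq R[i]) (t : seq R[i]) (s' : nat -> T -> K) :
  (\forall e \near F, perm_eq [seq s' i e | i <- iota 0 (size t)] (s e)) ->
  (forall i, (i < size t)%N -> s' i @ F --> (t`_i : K)) ->
  mset_cvg F s t.
Proof.
move=> ps st eta eta0.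
have eta0' : 0 < eta%:C%C :> K by rewrite ltcR.
have h : \forall e \near F, forall i : 'I_(size t), `|t`_i - s' i e| < eta%:C%C :> K.
  by apply: filter_forall => i; have /cvgrPdist_lt := st i (ltn_ord i); exact.
near=> e; exists [seq s' i e | i <- iota 0 (size t)]; first by near: e.
have h' : forall i : 'I_(size t), `|t`_i - s' i e| < eta%:C%C :> K by near: e.
rewrite all2E size_map size_iota eqxx /=; apply/(all_nthP (0, 0)) => i.
rewrite size_zip size_map size_iota minnn => it.
rewrite nth_zip ?size_map ?size_iota //= (nth_map 0%N) ?size_iota // nth_iota // add0n.
by rewrite distrC; exact: (h' (Ordinal it)).
Unshelve. all: by end_near.
Qed.

Lemma cvg_family_coef (S : {poly {poly R}}) i :
  (fun e => (S.[e%:P])`_i) @ (0 : R) --> (S.[0])`_i.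
Proof.
elim/poly_ind: S i => [|S p IH] i.
  by under eq_fun do rewrite horner0; rewrite horner0; exact: cvg_cst.
under eq_fun do rewrite hornerMXaddC coefD coefMC.
rewrite hornerMXaddC coefD -polyC0 coefMC.
by apply: cvgD; [apply: cvgM => //; rewrite polyC0; exact: IH | exact: cvg_cst].
Qed.

Lemma poly_disk_bound (p : {poly R}) (L : R) : 0 <= L -> exists2 M : R, 0 <= M &
  forall z : R[i], `|z| <= L%:C%C -> `|(cpoly p).[z]| <= M%:C%C.
Proof.
move=> L0; elim/poly_ind: p => [|p a [M M0 IH]].
  by exists 0 => // z _; rewrite /cpoly rmorph0 horner0 normr0.
exists (M * L + `|a|); first by rewrite addr_ge0 ?mulr_ge0.
move=> z zL; rewrite /cpoly rmorphD rmorphM /= map_polyX map_polyC /= hornerMXaddC.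
rewrite (le_trans (ler_normD _ _)) // rmorphD rmorphM /= lerD ?normc_real //.
by rewrite normrM ler_pM // IH.
Qed.

Lemma family_disk_bound (S : {poly {poly R}}) (L : R) : 0 <= L -> exists2 M : R, 0 <= M &
  forall (e : R) (z : R[i]), `|e| <= 1 -> `|z| <= L%:C%C ->
    `|(cpoly S.[e%:P]).[z]| <= M%:C%C.
Proof.
move=> L0; elim/poly_ind: S => [|S p [M M0 IH]].
  by exists 0 => // e z _ _; rewrite /cpoly horner0 rmorph0 horner0 normr0.
have [M' M'0 pM] := poly_disk_bound p L0.
exists (M + M'); first exact: addr_ge0.
move=> e z e1 zL; rewrite hornerMXaddC /cpoly rmorphD rmorphM /= map_polyC /= !hornerE.
rewrite (le_trans (ler_normD _ _)) // rmorphD /= lerD ?pM //.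
rewrite normrM normc_real (le_trans _ (IH e z e1 zL)) // ler_piMr //.
by rewrite -[1]/(1%:C%C) lecR.
Qed.

End Complex.

Lemma deriv_prod_XsubC_neq0 (F : fieldType) (s : seq F) x : uniq s -> x \in s ->
  (\prod_(y <- s) ('X - y%:P))^`().[x] != 0.
Proof.
move=> us xs; rewrite (perm_big _ (perm_to_rem xs)) /= big_cons derivM derivXsubC mul1r.
rewrite hornerD hornerM hornerXsubC subrr mul0r addr0 -rootE root_prod_XsubC.
by rewrite mem_rem_uniq // inE eqxx.
Qed.

Lemma map_ord_iota (A : Type) (r : nat) (f : nat -> A) :
  [seq f (val j) | j : 'I_r] = [seq f i | i <- iota 0 r].
Proof. by rewrite -val_enum_ord -map_comp. Qed.

(** * Splitting off and rescaling the cluster *)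

Section Cluster.
Variable R : realType.
Let K : numFieldType := R[i].
Variables (h : R -> {poly R}) (n r : nat) (c C : R) (Q : {poly R}) (S : {poly {poly R}}).
Hypotheses (hm : forall e, h e \is monic) (hsz : forall e, size (h e) = n.+1).
Hypothesis hc : forall i, (fun e => (h e)`_i) @ (0 : R) --> (h 0)`_i.
Hypotheses (Qm : Q \is monic) (Qsz : size Q = r.+1) (C0 : C != 0).
Hypothesis hS : forall e, h e \Po (c%:P + e *: 'X) = e ^+ r *: (C *: Q + e *: S.[e%:P]).

(** Only translated, not rescaled: here the cluster gathers at 0 and the coefficients still converge
    to those of [k 0]. *)
Let k e := h e \Po (c%:P + 'X).

Let k_scale e : k e \Po (e *: 'X) = e ^+ r *: (C *: Q + e *: S.[e%:P]).
Proof. by rewrite -hS /k -comp_polyA comp_polyD comp_polyC comp_polyX. Qed.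

Let k_cvg i : (fun e => (k e)`_i) @ (0 : R) --> (k 0)`_i.
Proof. by apply: (@cvg_coef_comp_poly _ _ _ _ n.+1) => // [e|]; rewrite hsz. Qed.

Let dnbhs_cvg (f : R -> R) (l : R) : f @ (0 : R) --> l -> f @ (0 : R)^' --> l.
Proof. by move=> fl; apply: cvg_trans fl; apply: cvg_app; exact: nbhs_dnbhs. Qed.

Lemma cvg_zoomed_coef i :
  (fun e => (C *: Q + e *: S.[e%:P])`_i) @ (0 : R) --> (C *: Q)`_i.
Proof.
have : (fun e => C * Q`_i + e * (S.[e%:P])`_i) @ (0 : R) --> C * Q`_i + 0 * (S.[0])`_i.
  apply: cvgD; first exact: cvg_cst.
  by apply: cvgM; [exact: cvg_id | exact: cvg_family_coef].
rewrite mul0r addr0 coefZ; apply: cvg_trans; apply: near_eq_cvg.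
by apply: nearW => e; rewrite coefD !coefZ.
Qed.

(** Off [e = 0] the i-th coefficient of [k e] is [e ^+ (r - i)] times a convergent one; its limit
    shows that 0 is a root of [k 0] of order exactly [r]. *)
Let k0_coef i : (i <= r)%N -> (k 0)`_i = if i == r then C else 0.
Proof.
move=> ir.
have kE : {near (0 : R)^', (fun e => e ^+ (r - i) * (C *: Q + e *: S.[e%:P])`_i) =1
    (fun e => (k e)`_i)}.
  near=> e; have e0 : e != 0 by near: e; exact: nbhs_dnbhs_neq.
  apply: (mulfI (expf_neq0 i e0)); rewrite mulrA -exprD subnKC //.
  by rewrite -coefZ -k_scale comp_poly_scaleX.
have c1 : (fun e => (k e)`_i) @ (0 : R)^' --> (0 ^+ (r - i) * (C *: Q)`_i).
  apply: cvg_trans (near_eq_cvg kE) _; apply: dnbhs_cvg; apply: cvgM.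
    exact: exprn_continuous.
  exact: cvg_zoomed_coef.
have := cvg_unique _ (dnbhs_cvg (k_cvg (i := i))) c1; move=> ->.
case: eqP => [->|/eqP ne].
  by rewrite subnn expr0 mul1r coefZ -[r in _`_r]/(r.+1.-1) -Qsz -lead_coefE (monicP Qm) mulr1.
by rewrite expr0n subn_eq0 leqNgt ltn_neqAle ne ir mul0r.
Unshelve. all: by end_near.
Qed.

Let s e : seq R[i] := [seq w - c%:C%C | w <- croots (h e)].

Let s_prod e : cpoly (k e) = \prod_(w <- s e) ('X - w%:P).
Proof.
rewrite /k /cpoly map_comp_poly -/(cpoly (h e)) (croots_prod (hm e)).
rewrite [map_poly _ _]rmorphD /= map_polyC map_polyX rmorph_prod big_map.
apply: eq_bigr => w _; rewrite /= comp_polyB comp_polyX comp_polyC.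
by rewrite polyCB; ring.
Qed.

Let s_size e : size (s e) = n.
Proof. by rewrite size_map size_croots // hsz. Qed.

Let far := [seq w <- s 0 | w != 0].

Let far_neq0 w : w \in far -> w != 0.
Proof. by rewrite mem_filter => /andP[]. Qed.

Let s0_perm : perm_eq (s 0) (nseq r 0 ++ far).
Proof.
have p1 : perm_eq (s 0) ([seq w <- s 0 | w == 0] ++ far) by rewrite perm_sym perm_filterC.
have n0 : [seq w <- s 0 | w == 0] = nseq (count_mem 0 (s 0)) 0.
  have /all_pred1P -> : all (pred1 0) [seq w <- s 0 | w == 0] by exact: filter_all.
  by rewrite size_filter.
suff cr : count_mem 0 (s 0) = r by rewrite n0 cr in p1.
have G0 : (\prod_(w <- far) ('X - w%:P) : {poly R[i]})`_0 != 0.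
  rewrite -horner_coef0 horner_prod prodf_seq_neq0; apply/allP => w /far_neq0.
  by rewrite hornerXsubC sub0r oppr_eq0.
have kE : cpoly (k 0) = 'X^(count_mem 0 (s 0)) * \prod_(w <- far) ('X - w%:P).
  rewrite s_prod (perm_big _ p1) /= big_cat /= n0; congr (_ * _).
  by rewrite big_nseq subr0 -Monoid.iteropE.
(* A smaller multiplicity would leave a nonzero coefficient below index [r], a larger one would
   cancel the coefficient [C] of index [r]. *)
have [lt|gt|//] := ltngtP (count_mem 0 (s 0)) r.
  have := k0_coef (ltnW lt); rewrite (ltn_eqF lt) => /(congr1 (real_complex R)).
  rewrite -coef_map -/(cpoly _) kE coefXnM ltnn subnn rmorph0 => e0.
  by rewrite e0 eqxx in G0.
have := k0_coef (leqnn r); rewrite eqxx => /(congr1 (real_complex R)).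
rewrite -coef_map -/(cpoly _) kE coefXnM gt => /esym/eqP.
by rewrite fmorph_eq0 (negbTE C0).
Qed.

(** Cluster zeros first: indices below [r] label the cluster, the others the far roots. *)
Let t := nseq r 0 ++ far.

Let size_t : size t = n.
Proof. by rewrite -(perm_size s0_perm) s_size. Qed.

Let t_lt i : (i < r)%N -> t`_i = 0.
Proof. by move=> ir; rewrite nth_cat size_nseq ir nth_nseq ir. Qed.

Let t_ge i : (r <= i < n)%N -> t`_i \in far.
Proof.
move=> /andP[ri i_n]; rewrite nth_cat size_nseq ltnNge ri /=; apply: mem_nth.
by rewrite ltn_subLR // -(size_nseq r (0 : R[i])) -size_cat size_t.
Qed.

Let r_le_n : (r <= n)%N.
Proof. by rewrite -size_t size_cat size_nseq leq_addr. Qed.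

Lemma cluster_branches : exists s' : nat -> R -> K,
  (forall e, perm_eq (s e) [seq s' i e | i <- iota 0 n]) /\
  (forall i, (i < n)%N -> s' i @ (0 : R) --> (t`_i : K)).
Proof.
have [|i|s' [p' c']] := @root_continuity K R (nbhs (0 : R)) _ t s.
- by move=> e; rewrite s_size size_t.
- rewrite -(perm_big _ s0_perm) /= -s_prod coef_map /=.
  under eq_fun do rewrite -s_prod coef_map /=.
  exact: cvg_real_complex.
by exists s'; rewrite size_t in p' c'.
Qed.

Let far_away : exists2 rho0 : R, 0 < rho0 & forall w, w \in far -> rho0%:C%C < `|w|.
Proof.
elim: far far_neq0 => [|w l IH] l0; first by exists 1.
have [|rho [rho0 rhol]] := IH; first by move=> v vl; apply: l0; rewrite in_cons vl orbT.
have /gtc0_real[w1 w10 w1E] : 0 < `|w| by rewrite normr_gt0 l0 // mem_head.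
exists (Num.min rho (w1 / 2)); first by rewrite lt_min rho0 divr_gt0.
move=> v; rewrite in_cons => /orP[/eqP ->|/rhol].
  by rewrite w1E ltcR gt_min; apply/orP; right; lra.
by apply: le_lt_trans; rewrite lecR ge_min lexx.
Qed.


(** The branches are fixed before [rho], so the same labelling describes the cluster for every small
    radius. *)
Definition is_branch_system (s' : nat -> R -> K) (rho0 : R) := [/\
  forall e, perm_eq (s e) [seq s' i e | i <- iota 0 n],
  forall i, (i < n)%N -> s' i @ (0 : R) --> (t`_i : K) &
  forall rho, 0 < rho -> rho < rho0 -> \forall e \near (0 : R),
    perm_eq (croots_near c rho (h e)) [seq s' i e + c%:C%C | i <- iota 0 r]].

Lemma exists_branch_system : exists s' rho0, 0 < rho0 /\ is_branch_system s' rho0.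
Proof.
have [s' [p' c']] := cluster_branches; have [rho0 rho00 farP] := far_away.
exists s', rho0; split => //; split => // rho rho_gt0 rho_lt.
have nri (i : 'I_n) : \forall e \near (0 : R),
    ((i < r)%N -> `|s' i e| < rho%:C%C) /\ ((r <= i)%N -> ~~ (`|s' i e| < rho%:C%C)).
  have /cvgrPdist_lt ci := c' i (ltn_ord i).
  have [ir|ri] := ltnP i r.
    have /ci : 0 < rho%:C%C :> K by rewrite ltcR.
    by apply: filterS => e; rewrite t_lt // sub0r normrN => ?; split.
  (* Far limits satisfy |t_i| > rho0, so staying within [rho0 - rho] of the limit keeps the branch
     out of the disk of radius [rho]. *)
  have /ci : 0 < (rho0 - rho)%:C%C :> K by rewrite ltcR subr_gt0.
  apply: filterS => e; rewrite rmorphB /= => lt; split=> //= _; apply/negP => lt'.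
  have ti : t`_i \in far by apply: t_ge; rewrite ri ltn_ord.
  have := le_lt_trans (ler_normD (t`_i - s' i e) (s' i e)) (ltrD lt lt').
  by rewrite !subrK => /(lt_trans (farP _ ti)); rewrite ltxx.
apply: filterS (filter_forall _ nri) => e nr.
have -> : croots_near c rho (h e) =
    [seq w + c%:C%C | w <- [seq w <- s e | `|w| < rho%:C%C]].
  rewrite /s filter_map -map_comp /= map_id_in //.
  by move=> w _ /=; rewrite subrK.
apply: (perm_trans (perm_map _ (perm_filter _ (p' e)))).
rewrite -[n in iota 0 n](subnKC r_le_n) iotaD map_cat filter_cat add0n.
rewrite (all_filterP _); last first.
  apply/allP => _ /mapP[i + ->]; rewrite mem_iota add0n => /= ir.
  by have [+ _] := nr (Ordinal (leq_trans ir r_le_n)); exact.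
rewrite [X in _ ++ X](_ : _ = [::]) ?cats0; first by rewrite -map_comp.
apply/eqP; rewrite -size_eq0 size_filter -leqn0 leqNgt -has_count; apply/hasPn.
move=> _ /mapP[i + ->]; rewrite mem_iota subnKC // => /andP[ri i_n].
by have [_] := nr (Ordinal i_n); exact.
Qed.

Lemma cluster_size :
  \forall rho \near (0 : R)^'+, \forall e \near (0 : R), size (croots_near c rho (h e)) = r.
Proof.
have [s' [rho0 [rho00 [_ _ nr]]]] := exists_branch_system.
near=> rho; have rho1 : 0 < rho by near: rho; exact: nbhs_right_gt.
have rho2 : rho < rho0 by near: rho; exact: nbhs_right_lt.
apply: filterS (nr rho rho1 rho2) => e /perm_size ->.
by rewrite size_map size_iota.
Unshelve. all: by end_near.
Qed.

(** After substituting [e *: 'X], the [r] cluster factors each give up one [e], which accounts for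
    [e ^+ r]; the far factors keep theirs. *)
Lemma rescaled_factor s' rho0 e : is_branch_system s' rho0 -> e != 0 ->
  cpoly (C *: Q + e *: S.[e%:P]) =
  (\prod_(i <- iota 0 r) ('X - (s' i e / e%:C%C)%:P)) *
  \prod_(i <- iota r (n - r)) (e%:C%C *: 'X - (s' i e)%:P).
Proof.
move=> [p' _ _] e0; have e0' : e%:C%C != 0 :> R[i] by rewrite fmorph_eq0.
have er0 : e%:C%C ^+ r != 0 :> R[i] by rewrite expf_neq0.
apply: (scalerI er0); rewrite scalerAl.
have <- : cpoly (k e \Po (e *: 'X)) = e%:C%C ^+ r *: cpoly (C *: Q + e *: S.[e%:P]).
  by rewrite k_scale /cpoly map_polyZ /= rmorphXn.
rewrite /cpoly map_comp_poly -/(cpoly (k e)) s_prod (perm_big _ (p' e)) big_map.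
rewrite -[n in iota 0 n](subnKC r_le_n) iotaD big_cat rmorphM /= add0n.
rewrite map_polyZ map_polyX /= !rmorph_prod; congr (_ * _).
  rewrite -[X in _ ^+ X](size_iota 0 r); elim: (iota 0 r) => [|i l IH].
    by rewrite !big_nil scale1r.
  rewrite !big_cons IH /= comp_polyB comp_polyX comp_polyC exprS -scalerA.
  rewrite scalerAr scalerAl; congr (_ * _).
  by rewrite scalerBr -[in RHS]mul_polyC [in RHS]mul_polyC -(mul_polyC _ (_ / _)%:P)
    -polyCM mulrCA mulfV // mulr1.
by apply: eq_bigr => i _; rewrite /= comp_polyB comp_polyX comp_polyC.
Qed.

Let dnbhs_cvgK (f : R -> K) (l : K) : f @ (0 : R) --> l -> f @ (0 : R)^' --> l.
Proof. by move=> fl; apply: cvg_trans fl; apply: cvg_app; exact: nbhs_dnbhs. Qed.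

Lemma rescaled_near_cvg s' rho0 i : is_branch_system s' rho0 ->
  (fun e => (\prod_(i <- iota 0 r) ('X - (s' i e / e%:C%C)%:P))`_i : K) @ (0 : R)^' -->
  ((cpoly Q)`_i : K).
Proof.
move=> bs; have [_ c' _] := bs.
set N := fun e => \prod_(i <- iota 0 r) ('X - (s' i e / e%:C%C)%:P).
pose G e : {poly K} := \prod_(i <- iota r (n - r)) (e%:C%C *: 'X - (s' i e)%:P).
pose g0 : K := \prod_(i <- iota r (n - r)) - t`_i.
have g00 : g0 != 0.
  rewrite prodf_seq_neq0; apply/allP => j; rewrite mem_iota subnKC // => jn /=.
  by rewrite oppr_eq0; apply: far_neq0; exact: t_ge.
have PE : \forall e \near (0 : R)^', cpoly (C *: Q + e *: S.[e%:P]) = N e * G e.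
  near=> e; apply: rescaled_factor bs _; near: e; exact: nbhs_dnbhs_neq.
have cP j : (fun e => (cpoly (C *: Q + e *: S.[e%:P]))`_j : K) @ (0 : R)^' -->
    ((cpoly (C *: Q))`_j : K).
  apply: dnbhs_cvgK; rewrite coef_map /=; under eq_fun do rewrite coef_map /=.
  by apply: cvg_real_complex; exact: cvg_zoomed_coef.
have cG j : (fun e => (G e)`_j) @ (0 : R)^' --> (g0%:P)`_j.
  apply: dnbhs_cvgK; apply: (@cvg_coef_prod_scaled K R (nbhs (0 : R)) _) => [|l].
    have id0 : id @ (0 : R) --> (0 : R) by exact: cvg_id.
    by have /(_ _) := @cvg_real_complex R _ (nbhs (0 : R)) _ _ _ id0; rewrite rmorph0; exact.
  by rewrite mem_iota subnKC // => /andP[_ ln]; exact: c'.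
have cN j : (fun e => (N e)`_j) @ (0 : R)^' --> ((cpoly (C *: Q))`_j / g0 : K).
  exact: cvg_coef_quotient_unit g00 PE cP cG.
(* The near factor is monic for every [e]: its coefficient of index [r] is always 1, which
   identifies the far limit [g0] with [C] without computing it. *)
have Cg : C%:C%C / g0 = 1.
  have N1 e : (N e)`_r = 1.
    have sN : size (N e) = r.+1 by rewrite size_prod_XsubC size_iota.
    have : N e \is monic by apply: monic_prod_XsubC.
    by move=> /monicP; rewrite lead_coefE sN.
  have c1 : (fun=> 1 : K) @ (0 : R)^' --> (C%:C%C / g0 : K).
    have := cN r; rewrite coef_map coefZ -[r in Q`_r]/(r.+1.-1) -Qsz -lead_coefE (monicP Qm) mulr1.
    by under eq_fun do rewrite N1.
  have c2 : (fun=> 1 : K) @ (0 : R)^' --> (1 : K) by exact: cvg_cst.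
  exact: (cvg_unique (@norm_hausdorff _ _) c1 c2).
have -> : (cpoly Q)`_i = (cpoly (C *: Q))`_i / g0.
  by rewrite !coef_map /= coefZ rmorphM /= mulrAC Cg mul1r.
exact: cN.
Unshelve. all: by end_near.
Qed.

Lemma cluster_rescaled : \forall rho \near (0 : R)^'+,
  mset_cvg (0 : R)^' (fun e => [seq ((w - c%:C) / e%:C)%C | w <- croots_near c rho (h e)])
    (croots Q).
Proof.
have [s' [rho0 [rho00 bs]]] := exists_branch_system; have [_ _ nr] := bs.
near=> rho; have rho1 : 0 < rho by near: rho; exact: nbhs_right_gt.
have rho2 : rho < rho0 by near: rho; exact: nbhs_right_lt.
have szQ : size (croots Q) = r by rewrite size_croots // Qsz.
(* Root continuity a second time, now for the rescaled cluster and along the punctured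
   neighbourhood. *)
have [||s'' [p'' c'']] := @root_continuity K R (0 : R)^' _ (croots Q)
    (fun e => [seq s' i e / e%:C%C | i <- iota 0 r]).
- by move=> e; rewrite size_map size_iota szQ.
- move=> i; rewrite -croots_prod //; under eq_fun do rewrite big_map.
  exact: rescaled_near_cvg bs.
apply: mset_cvg_componentwise c''.
have := nbhs_dnbhs (nr rho rho1 rho2); apply: filterS => e pe.
rewrite -(permPl (p'' e)) perm_sym (permPl (perm_map _ pe)) -map_comp.
rewrite (eq_map (g := fun i => s' i e / e%:C%C)) //.
by move=> i /=; rewrite addrK.
Unshelve. all: by end_near.
Qed.


Lemma cluster_analytic : (forall w, w \in croots Q -> complex.Im w = 0) -> uniq (croots Q) ->
  exists (lambda : 'I_r -> R) (x : 'I_r -> R -> R),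
    [/\ (forall i j : 'I_r, (i < j)%N -> lambda i < lambda j) /\
        perm_eq (croots Q) [seq (lambda j)%:C%C | j : 'I_r],
        \forall rho \near (0 : R)^'+, \forall eps \near (0 : R),
          perm_eq (croots_near c rho (h eps)) [seq (x j eps)%:C%C | j : 'I_r],
        forall j : 'I_r, real_analytic_at (x j) 0,
        forall j : 'I_r, (fun eps : R => x j eps - (c + eps * lambda j))
            =O_ (0 : R) (fun eps : R => eps ^+ 2) &
        (\forall eps \near (0 : R)^'+, forall i j : 'I_r, (i < j)%N -> x i eps < x j eps) /\
        (\forall eps \near (0 : R)^'-, forall i j : 'I_r, (i < j)%N -> x j eps < x i eps)].
Proof.
move=> Qreal Qu.
pose lam := sort <=%R [seq complex.Re w | w <- croots Q].
have lamE : perm_eq (croots Q) [seq x%:C%C | x <- lam].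
  rewrite perm_sym; apply: (perm_trans (perm_map _ (permEl (perm_sort _ _)))).
  rewrite -map_comp map_id_in // => w /Qreal.
  by case: w => a b /= ->.
have ulam : uniq lam by move: Qu; rewrite (perm_uniq lamE) => /map_uniq.
have slam : size lam = r.
  by rewrite size_sort size_map size_croots // Qsz.
have ltlam : sorted <%R lam by rewrite lt_sorted_uniq_le ulam sort_le_sorted.
have QE : Q = \prod_(x <- lam) ('X - x%:P).
  apply: (map_inj_poly (@complexI R) (rmorph0 _)).
  rewrite -[LHS]/(cpoly Q) croots_prod // (perm_big _ lamE) big_map rmorph_prod.
  by apply: eq_bigr => x _; rewrite /= map_polyXsubC.
pose lambda (j : 'I_r) := lam`_j.
have lt_lambda (i j : 'I_r) : (i < j)%N -> lambda i < lambda j.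
  by move=> ij; rewrite /lambda (lt_sorted_ltn_nth 0 ltlam) ?inE ?slam.
have lamj (j : 'I_r) : lambda j \in lam by apply: mem_nth; rewrite slam.
have Qroot j : Q.[lambda j] = 0.
  by apply/eqP; rewrite -rootE {1}QE root_prod_XsubC.
have Qder j : Q^`().[lambda j] != 0.
  by rewrite {1}QE; apply: deriv_prod_XsubC_neq0.
(* [S] has the parameter as outer variable, whereas [analytic_root] solves for the outer one; hence
   the swap. *)
pose H := swapXY ((C *: Q)%:P + 'X * S).
have HE x y : H.[x%:P].[y] = (C *: Q + y *: S.[y%:P]).[x].
  by rewrite horner2_swapXY hornerD hornerM hornerX hornerC mul_polyC.
have H0 : map_poly (horner_eval 0) H = C *: Q.
  by rewrite -horner_swapXY swapXYK hornerD hornerM hornerX hornerC mul0r addr0.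
have /choice[f fP] : forall j : 'I_r, exists p : R^nat * (R * R),
  [/\ 0 < p.2.1, 0 <= p.2.2, p.1 0%N = lambda j &
  forall y, `|y| < p.2.1 -> exists l : R, [/\ pseries p.1 y @ \oo --> l,
     H.[l%:P].[y] = 0 & `|l - lambda j| <= p.2.2 * `|y|]].
  move=> j; have [||a [rho [K0 aP]]] := @analytic_root R H (lambda j).
  - by rewrite HE scale0r addr0 hornerZ Qroot mulr0.
  - have -> : H^`().[(lambda j)%:P].[0] = (map_poly (horner_eval 0) H)^`().[lambda j].
      by rewrite deriv_map -horner_swapXY horner2_swapXY.
    by rewrite H0 derivZ hornerZ mulf_neq0.
  by exists (a, (rho, K0)).
pose rad j := (f j).2.1; pose Lip j := (f j).2.2.
have rad0 j : 0 < rad j by have [] := fP j.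
have Lip0 j : 0 <= Lip j by have [] := fP j.
pose z j y := limn (pseries (f j).1 y).
have zP j y : `|y| < rad j -> [/\ pseries (f j).1 y @ \oo --> z j y,
    H.[(z j y)%:P].[y] = 0 & `|z j y - lambda j| <= Lip j * `|y|].
  move=> yr; have [_ _ _ /(_ y yr)[l [l1 l2 l3]]] := fP j.
  by have -> : z j y = l by apply: cvg_lim.
have near_lt (d : R) : 0 < d -> \forall y \near (0 : R), `|y| < d by exact: nbhs0_lt.
have near_rad : \forall y \near (0 : R), forall j, `|y| < rad j.
  have nrad j : \forall y \near (0 : R), `|y| < rad j by exact: near_lt.
  exact: (filter_forall _ nrad).
have z_cvg j : z j @ (0 : R) --> lambda j.
  apply/cvgrPdist_lt => eps eps0.
  have L1 : 0 < Lip j + 1 by rewrite ltr_wpDl.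
  have eL : 0 < eps / (Lip j + 1) by exact: divr_gt0.
  near=> y; have yr : `|y| < rad j by near: y; exact: near_lt.
  have [_ _] := zP j y yr; rewrite distrC => /le_lt_trans; apply.
  have : `|y| < eps / (Lip j + 1) by near: y; exact: near_lt.
  rewrite ltr_pdivlMr // => /le_lt_trans; apply.
  by rewrite mulrC ler_wpM2l // lerDl ler01.
have z_lt : \forall y \near (0 : R), forall i j : 'I_r, (i < j)%N -> z i y < z j y.
  suff z_ltij (i j : 'I_r) : \forall y \near (0 : R), (i < j)%N -> z i y < z j y.
    exact: (filter_forall _ (fun i => filter_forall _ (z_ltij i))).
  have [ij|ji] := ltnP i j; last by near=> y.
  have lt := lt_lambda _ _ ij.
  have [m1 m2] := midf_lt lt; set m := (_ / _) in m1 m2.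
  near=> y; move=> _; apply: (@lt_trans _ _ m); near: y.
    exact: (cvgr_lt _ (z_cvg i)).
  exact: (cvgr_gt _ (z_cvg j)).
pose x j y := c + y * z j y.
have [s' [rho0 [rho00 [p' c' nr]]]] := exists_branch_system.
exists lambda, x; split.
- split; first exact: lt_lambda.
  rewrite (permPl lamE) (map_ord_iota _ (fun i => (lam`_i)%:C%C)).
  by rewrite -[X in perm_eq _ X]/(map _ _) -slam (map_comp (real_complex R) (nth 0 lam)) map_nth_iota0 // take_size.
- near=> rho; have rho1 : 0 < rho by near: rho; exact: nbhs_right_gt.
  have rho2 : rho < rho0 by near: rho; exact: nbhs_right_lt.
  have small : \forall y \near (0 : R), forall j, `|y * z j y| < rho.
    suff smallj j : \forall y \near (0 : R), `|y * z j y| < rho.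
      exact: (filter_forall _ smallj).
    have yz : (fun y => y * z j y) @ (0 : R) --> 0 * lambda j.
      by apply: cvgM; [exact: cvg_id | exact: z_cvg].
    rewrite mul0r in yz; have /cvgrPdist_lt/(_ rho rho1) := yz.
    by apply: filterS => y; rewrite sub0r normrN.
  near=> e.
  have pe : perm_eq (croots_near c rho (h e)) [seq s' i e + c%:C%C | i <- iota 0 r].
    by near: e; exact: nr.
  have lte : forall i j : 'I_r, (i < j)%N -> z i e < z j e by near: e.
  have smalle : forall j, `|e * z j e| < rho by near: e.
  have rade : forall j, `|e| < rad j by near: e.
  (* At [e = 0] all branches meet at [c] and no distinctness is available; convergence along the
     full neighbourhood forces [s' i 0 = 0]. *)
  have [e0|e0] := eqVneq e 0.
    rewrite (permPl pe) [X in perm_eq _ X](_ : _ = [seq c%:C%C | _ <- iota 0 r]); last first.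
      rewrite -(map_ord_iota r (fun=> c%:C%C)); apply: eq_map => j.
      by rewrite /x e0 mul0r addr0.
    rewrite e0.
    rewrite [X in perm_eq X _](_ : _ = [seq c%:C%C | _ <- iota 0 r]) //.
    apply/eq_in_map => i; rewrite mem_iota add0n => /= ir.
    suff -> : s' i 0 = 0 by rewrite add0r.
    apply/eqP; rewrite -normr_eq0 -[_ == 0]negbK; apply/negP => s'0.
    have s'0' : 0 < `|s' i 0| by rewrite lt_def s'0 normr_ge0.
    have /cvgrPdist_lt/(_ _ s'0')/nbhs_singleton := c' i (leq_trans ir r_le_n).
    by rewrite t_lt // sub0r normrN ltxx.
  (* For [e != 0] the [r] values are distinct roots in the disk, which holds exactly [r] roots with
     multiplicity; so they are all of them. *)
  have uX : uniq [seq (x j e)%:C%C | j : 'I_r].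
    rewrite map_inj_uniq ?enum_uniq // => i j /complexI/addrI/(mulfI e0) zij.
    case: (ltngtP i j) => [/lte|/lte|/val_inj //]; by rewrite zij ltxx.
  have sX : {subset [seq (x j e)%:C%C | j : 'I_r] <= croots_near c rho (h e)}.
    move=> _ /mapP[j _ ->]; rewrite mem_filter; apply/andP; split.
      by rewrite -rmorphB normc_real ltcR /x addrC addKr.
    rewrite -root_prod_XsubC -croots_prod // rootE /cpoly horner_map /=.
    have -> : (h e).[x j e] = (h e \Po (c%:P + e *: 'X)).[z j e].
      by rewrite horner_comp !hornerE.
    have [_ Hz _] := zP j e (rade j).
    by rewrite hS hornerZ -HE Hz mulr0 rmorph0.
  have sz : (size (croots_near c rho (h e)) <= size [seq (x j e)%:C%C | j : 'I_r])%N.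
    by rewrite (perm_size pe) size_map size_iota size_image card_ord.
  rewrite perm_sym; apply: uniq_perm => //; first exact: leq_size_uniq uX sX sz.
  by have [] := uniq_min_size uX sX sz.
(* Multiplication by [y] shifts the series of [z j] by one place and leaves room for the constant
   term [c]. *)
- move=> j; exists (fun k => if k is k'.+1 then (f j).1 k' else c).
  near=> y; rewrite subr0.
  have yr : `|y| < rad j by near: y; exact: near_lt.
  have [zc _ _] := zP j y yr.
  rewrite -(cvg_shiftS (pseries _ y)).
  rewrite [X in X @ _ --> _](_ : _ = (fun N => c + y * pseries (f j).1 y N)); last first.
    apply/funext => N; rewrite /pseries /series /= big_nat_recl // expr0 mulr1; congr (_ + _).
    by rewrite mulr_sumr; apply: eq_bigr => m _; rewrite exprS; ring.
  by apply: cvgD; [exact: cvg_cst | apply: cvgM => //; exact: cvg_cst].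
- move=> j; apply/eqO_exP; exists (Lip j + 1); first by rewrite ltr_wpDl.
  near=> y.
  have yr : `|y| < rad j by near: y; exact: near_lt.
  have [_ _ zl] := zP j y yr.
  have -> : x j y - (c + y * lambda j) = y * (z j y - lambda j) by rewrite /x; ring.
  rewrite normrM normrX expr2 mulrA [leRHS]mulrC ler_wpM2l // (le_trans zl) //.
  by rewrite ler_wpM2r // lerDl ler01.
- split; near=> y.
    have y0 : 0 < y by near: y; exact: nbhs_right_gt.
    have lte : forall i j : 'I_r, (i < j)%N -> z i y < z j y.
      by near: y; apply: cvg_within; exact: z_lt.
    by move=> i j /lte; rewrite /x ltrD2l ltr_pM2l.
  have y0 : y < 0 by near: y; exact: nbhs_left_lt.
  have lte : forall i j : 'I_r, (i < j)%N -> z i y < z j y.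
    by near: y; apply: cvg_within; exact: z_lt.
  by move=> i j /lte; rewrite /x ltrD2l ltr_nM2l.
Unshelve. all: by end_near.
Qed.

End Cluster.

(** * Rescaling at a pair of roots *)

Section Assembly.
Variable R : realType.

(** The error is [eps] times the value of [S], bounded by |eps| M on the disk of radius |z| + 1 for
    |eps| <= 1; [M + 1] serves as a positive denominator. *)
Lemma locally_uniform_zoom (h : R -> {poly R}) r c C (Q : {poly R}) (S : {poly {poly R}}) :
  (forall e, h e \Po (c%:P + e *: 'X) = e ^+ r *: (C *: Q + e *: S.[e%:P])) ->
  locally_uniform_cvg (0 : R)^'
    (fun eps z => (eps%:C ^- r * (cpoly (h eps)).[c%:C + eps%:C * z])%C)
    (fun z => (C%:C * (cpoly Q).[z])%C).
Proof.
move=> hS z; exists (ball z 1); first exact: nbhsx_ballx.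
move=> P /uniform_nbhs [E [entE EP]].
move: entE; rewrite -entourage_ballE => -[_ /gtc0_real[d d0 ->] dE].
have [L L0 zL] : exists2 L : R, 0 <= L & `|z| + 1 = L%:C%C.
  exists (complex.Re (`|z| + 1)).
    by have : 0 <= `|z| + 1 :> R[i] by []; rewrite lecE => /andP[].
  by rewrite RRe_real // ger0_real.
have [M M0 SM] := family_disk_bound S L0.
have dM : 0 < d / (M + 1) by apply: divr_gt0 => //; rewrite ltr_wpDl.
rewrite nbhs_simpl /=; near=> e; apply: EP => w zw; apply: dE.
have e0 : e != 0 by near: e; exact: nbhs_dnbhs_neq.
have e1 : `|e| <= 1 by near: e; apply: dnbhs0_le.
have eM : `|e| < d / (M + 1) by near: e; apply: dnbhs0_lt.
have wL : `|w| <= L%:C%C.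
  rewrite -zL -[w](subrK z) addrC (le_trans (ler_normD _ _)) // lerD2l ltW //.
  by rewrite distrC.
have -> : (e%:C ^- r * (cpoly (h e)).[c%:C + e%:C * w])%C =
    C%:C%C * (cpoly Q).[w] + e%:C%C * (cpoly S.[e%:P]).[w].
  have -> : (cpoly (h e)).[(c%:C + e%:C * w)%C] = (cpoly (h e \Po (c%:P + e *: 'X))).[w].
    rewrite /cpoly map_comp_poly horner_comp rmorphD /= map_polyC map_polyZ map_polyX.
    by rewrite !hornerE.
  rewrite hS /cpoly map_polyZ rmorphD /= !map_polyZ hornerZ hornerD !hornerZ /= rmorphXn mulKf //.
  by rewrite expf_neq0 // fmorph_eq0.
rewrite /ball /= opprD addrA subrr sub0r normrN normrM normc_real.
apply: (@le_lt_trans _ _ (`|e| * M)%:C%C).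
  by rewrite rmorphM /= ler_wpM2l ?ler0c //; exact: SM.
rewrite ltcR; move: eM; rewrite ltr_pdivlMr ?ltr_wpDl //; apply: le_lt_trans.
by rewrite ler_wpM2l // lerDl.
Unshelve. all: by end_near.
Qed.

Lemma map_free_conv d (p q : {poly R}) :
  cpoly (free_conv d p q) = free_conv d (cpoly p) (cpoly q).
Proof.
rewrite /free_conv /cpoly rmorph_sum; apply: eq_bigr => k _.
rewrite /= map_polyZ map_polyXn rmorphM /= rmorphXn rmorphN1 rmorph_sum; congr ((_ * _) *: _).
apply: eq_bigr => i _; rewrite rmorph_sum; apply: eq_bigr => j _.
rewrite /signed_coef !rmorphM /= fmorphV !rmorph_nat !rmorphXn !rmorphN1 !coef_map.
by rewrite rmorphM !rmorph_nat.
Qed.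

Lemma root_poly_monic n (alpha : 'rV[R]_n) : root_poly alpha \is monic.
Proof. exact: monic_prod_XsubC. Qed.

Lemma size_root_poly n (alpha : 'rV[R]_n) : size (root_poly alpha) = n.+1.
Proof. by rewrite /root_poly size_prod_XsubC [index_enum _]unlock -enumT size_enum_ord. Qed.

(** The zoom with [u = 0] and scale 1 is a translation, and displays a power of ['X] whose exponent
    is the multiplicity of [a]. *)
Lemma derivn_root_poly_eq0 n (alpha : 'rV[R]_n) (a : R) j :
  (j < #|[set i : 'I_n | alpha 0%R i == a]%SET|)%N -> (root_poly alpha)^`(j).[a] = 0.
Proof.
move=> jm; have := root_poly_zoom alpha 0 a 1.
rewrite scaler0 addr0 expr1n !scale1r; set A := zoom_cofactor _ _ _ _ => e.
have {e} : ((root_poly alpha \Po (a%:P + 'X))^`(j)).[0] = 0.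
  rewrite e horner_coef0 coef_derivn addn0.
  rewrite (eq_bigr (fun=> 'X)) => [|i _]; last by rewrite mxE subr0.
  by rewrite prodr_const coefXnM jm mul0rn.
by rewrite -['X]scale1r derivn_comp_affine expr1n scale1r horner_comp !hornerE.
Qed.

Lemma poly_family_root_poly n (alpha u : 'rV[R]_n) :
  poly_family (fun e => root_poly (alpha + e *: u)).
Proof.
apply: poly_family_prod => i.
have -> : (fun e => 'X - ((alpha + e *: u) 0 i)%:P) =
    (fun e => ('X - (alpha 0 i)%:P) + e *: - (u 0 i)%:P).
  by apply/funext => e; rewrite !mxE polyCD polyCM -mul_polyC; ring.
by apply: poly_familyD; [|apply: poly_familyZ]; exact: poly_family_cst.
Qed.

Lemma cvg_poly_family_coef (f : R -> {poly R}) i : poly_family f ->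
  (fun e => (f e)`_i) @ (0 : R) --> (f 0)`_i.
Proof. by move=> [S fS]; under eq_fun do rewrite fS; rewrite fS polyC0; exact: cvg_family_coef. Qed.

Lemma upper_stableZ (c : R[i]) (p : {poly R[i]}) : c != 0 -> upper_stable p ->
  upper_stable (c *: p).
Proof. by move=> c0 sp z z0; rewrite hornerZ mulf_neq0 // sp. Qed.

(** * Expansion at the sum of two roots *)

Section Main.
Variables (n : nat) (alpha beta u v : 'rV[R]_n) (a b : R).
Let p := fun eps : R => root_poly (alpha + eps *: u).
Let q := fun eps : R => root_poly (beta + eps *: v).
Let h := fun eps : R => free_conv n (p eps) (q eps).
Let I := [set i : 'I_n | alpha 0 i == a]%SET.
Let J := [set j : 'I_n | beta 0 j == b]%SET.
Let m := #|I|.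
Let k := #|J|.
Let r := (m + k - n)%N.
Let U : {poly R} := \prod_(i in I) ('X - (u 0 i)%:P).
Let V : {poly R} := \prod_(j in J) ('X - (v 0 j)%:P).
Let Q : {poly R} := free_conv r ((r`!%:R / m`!%:R) *: U^`(m - r))
                                ((r`!%:R / k`!%:R) *: V^`(k - r)).
Let ctan : R := (m`! * k`!)%:R / (n`! * r`!)%:R
                * \prod_(i | i \notin I) (a - alpha 0 i)
                * \prod_(j | j \notin J) (b - beta 0 j).
Hypothesis nmk : (n < m + k)%N.

Let mn : (m <= n)%N.
Proof. by rewrite /m -[X in (_ <= X)%N]card_ord max_card. Qed.

Let kn : (k <= n)%N.
Proof. by rewrite /k -[X in (_ <= X)%N]card_ord max_card. Qed.

Let mkr : (m + k = n + r)%N.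
Proof. by rewrite /r subnKC // ltnW. Qed.

Let rm : (r <= m)%N.
Proof. by rewrite -(leq_add2r k) mkr addnC leq_add2r. Qed.

Let rk : (r <= k)%N.
Proof. by rewrite -(leq_add2l m) mkr leq_add2r. Qed.

Let r_gt0 : (0 < r)%N.
Proof. by rewrite subn_gt0. Qed.

Let U_monic : U \is monic. Proof. exact: monic_prod_XsubC. Qed.
Let V_monic : V \is monic. Proof. exact: monic_prod_XsubC. Qed.
Let size_U : size U = m.+1. Proof. exact: size_prod_in. Qed.
Let size_V : size V = k.+1. Proof. exact: size_prod_in. Qed.

Lemma tangent_monic : Q \is monic /\ size Q = r.+1.
Proof.
have [mU sU] := derivn_monic_scaled rm U_monic size_U.
have [mV sV] := derivn_monic_scaled rk V_monic size_V.
exact: free_conv_monic.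
Qed.

Lemma ctan_neq0 : ctan != 0.
Proof.
rewrite /ctan !mulf_neq0 ?invr_neq0 ?natrM ?mulf_neq0 ?fact_neq0 //.
  by apply/prodf_neq0 => i; rewrite inE subr_eq0 eq_sym.
by apply/prodf_neq0 => i; rewrite inE subr_eq0 eq_sym.
Qed.

Lemma h_monic e : h e \is monic /\ size (h e) = n.+1.
Proof. by apply: free_conv_monic; rewrite ?root_poly_monic ?size_root_poly. Qed.

Lemma h_cvg i : (fun e => (h e)`_i) @ (0 : R) --> (h 0)`_i.
Proof.
apply: cvg_poly_family_coef; apply: poly_family_free_conv.
- by move=> e; rewrite size_root_poly.
- exact: poly_family_root_poly.
- exact: poly_family_root_poly.
Qed.

Let UA e := U * zoom_cofactor alpha u a e.
Let VB e := V * zoom_cofactor beta v b e.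

Lemma h_zoom e : h e \Po ((a + b)%:P + e *: 'X) = e ^+ r *: free_conv n (UA e) (VB e).
Proof.
have [->|e0] := eqVneq e 0.
  (* Cancelling [e ^+ n] is impossible at [e = 0]; there the claim is that [a + b] is a root of
     [h 0]. In each term of the pairing either [t < k] or [n - t < m], so one factor vanishes. *)
  rewrite scale0r addr0 comp_polyCr expr0n eqn0Ngt r_gt0 scale0r.
  suff -> : (h 0).[a + b] = 0 by [].
  apply: (mulfI (fact_neq0 R n)); rewrite mulr0 horner_free_conv ?size_root_poly //.
  apply: big1 => t _; rewrite /p /q !scale0r !addr0.
  have [tk|kt] := ltnP t k; first by rewrite (derivn_root_poly_eq0 tk) mul0r.
  rewrite [X in _ * X]derivn_root_poly_eq0 ?mulr0 // -/I -/m.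
  by have := leq_ord t; move: nmk mn kt; lia.
apply: (scalerI (expf_neq0 n e0)); rewrite -free_conv_affine ?size_root_poly //.
by rewrite !root_poly_zoom free_convZ scalerA -!exprD -/m -/k mkr.
Qed.

(** At [e = 0] the cofactors are the constant products in [ctan]. Passing from degree [n] to [r]
    costs r!/n!, and the normalisations r!/m! and r!/k! inside [Q] account for the remaining
    factorials. *)
Lemma h_zoom_family : exists S : {poly {poly R}}, forall e,
  h e \Po ((a + b)%:P + e *: 'X) = e ^+ r *: (ctan *: Q + e *: S.[e%:P]).
Proof.
have [|S HS] := @poly_family_split R (fun e => free_conv n (UA e) (VB e)).
  apply: poly_family_free_conv; first by move=> e; exact: size_zoom.
  - exact: poly_family_zoom.
  - exact: poly_family_zoom.
exists S => e; rewrite h_zoom HS; congr (_ *: (_ + _)).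
rewrite /UA /VB !zoom_cofactor0 ![_ * _%:P]mulrC !mul_polyC free_convZ.
rewrite /Q free_convZ scalerA.
apply: (scalerI (fact_neq0 R n)); rewrite [LHS]scalerA [X in X *: _ = _]mulrC -[LHS]scalerA.
rewrite (@free_conv_derivn R n m k r) ?size_U ?size_V // !scalerA; congr (_ *: _).
rewrite /ctan !natrM; field.
by rewrite !fact_neq0.
Qed.

(** Gauss-Lucas keeps the derivatives of [U] and [V] stable, Walsh's theorem then their convolution,
    and real coefficients force the roots onto the real line. *)
Lemma tangent_real w : w \in croots Q -> complex.Im w = 0.
Proof.
have [Qm _] := tangent_monic; move=> wQ; apply: (@upper_stable_real_root R Q).
  rewrite -/(cpoly Q) /Q map_free_conv.
  have [_ sU] := derivn_monic_scaled rm U_monic size_U.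
  have [_ sV] := derivn_monic_scaled rk V_monic size_V.
  apply: upper_stable_free_conv; rewrite ?size_map_poly //.
    rewrite /cpoly map_polyZ -derivn_map; apply: upper_stableZ.
      by rewrite fmorph_eq0 mulf_neq0 ?invr_neq0 ?fact_neq0.
    apply: upper_stable_derivn; first by rewrite size_map_poly size_U; move: rm; lia.
    exact: upper_stable_prod_real.
  rewrite /cpoly map_polyZ -derivn_map; apply: upper_stableZ.
    by rewrite fmorph_eq0 mulf_neq0 ?invr_neq0 ?fact_neq0.
  apply: upper_stable_derivn; first by rewrite size_map_poly size_V; move: rk; lia.
  exact: upper_stable_prod_real.
by rewrite -/(cpoly Q) croots_prod // root_prod_XsubC.
Qed.

End Main.
End Assembly.

Theorem theorem6p1 (R : realType) (n : nat) (hn : (2 <= n)%N)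
    (alpha beta u v : 'rV[R]_n) (a b : R) :
  let p := fun eps : R => root_poly (alpha + eps *: u) in
  let q := fun eps : R => root_poly (beta + eps *: v) in
  let h := fun eps : R => free_conv n (p eps) (q eps) in
  let I := [set i : 'I_n | alpha 0 i == a]%SET in
  let J := [set j : 'I_n | beta 0 j == b]%SET in
  let m := #|I| in
  let k := #|J| in
  let r := (m + k - n)%N in
  let U : {poly R} := \prod_(i in I) ('X - (u 0 i)%:P) in
  let V : {poly R} := \prod_(j in J) ('X - (v 0 j)%:P) in
  let Q : {poly R} := free_conv r ((r`!%:R / m`!%:R) *: U^`(m - r))
                                  ((r`!%:R / k`!%:R) *: V^`(k - r)) in
  let ctan : R := (m`! * k`!)%:R / (n`! * r`!)%:R
                  * \prod_(i | i \notin I) (a - alpha 0 i)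
                  * \prod_(j | j \notin J) (b - beta 0 j) in
  (* h_eps(a + b + eps z), as a polynomial in z *)
  let hz := fun eps : R => h eps \Po ((a + b)%:P + eps *: 'X) in
  root (p 0) a -> root (q 0) b -> (n < m + k)%N ->
  [/\ Q \is monic /\ size Q = r.+1,
      ctan != 0,
      (* an element of R[z][eps] : the outer variable is eps *)
      exists S : {poly {poly R}}, forall eps : R,
        hz eps = eps ^+ r *: (ctan *: Q + eps *: S.[eps%:P]),
      (forall i : nat, (eps ^- r * (hz eps)`_i) @[eps --> (0 : R)^'] -->
                       (ctan *: Q)`_i) /\
      locally_uniform_cvg (0 : R)^'
        (fun eps z => (eps%:C ^- r * (cpoly (h eps)).[(a + b)%:C + eps%:C * z])%C)
        (fun z => (ctan%:C * (cpoly Q).[z])%C) &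
      [/\ \forall rho \near (0 : R)^'+, \forall eps \near (0 : R),
            size (croots_near (a + b) rho (h eps)) = r,
          \forall rho \near (0 : R)^'+,
            mset_cvg (0 : R)^'
              (fun eps => [seq ((w - (a + b)%:C) / eps%:C)%C
                             | w <- croots_near (a + b) rho (h eps)])
              (croots Q) &
          uniq (croots Q) ->
          exists (lambda : 'I_r -> R) (x : 'I_r -> R -> R),
            [/\ (forall i j : 'I_r, (i < j)%N -> lambda i < lambda j) /\
                perm_eq (croots Q) [seq (lambda j)%:C%C | j : 'I_r],
                \forall rho \near (0 : R)^'+, \forall eps \near (0 : R),
                  perm_eq (croots_near (a + b) rho (h eps))
                          [seq (x j eps)%:C%C | j : 'I_r],
                forall j : 'I_r, real_analytic_at (x j) 0,
                forall j : 'I_r,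
                  (fun eps : R => x j eps - (a + b + eps * lambda j))
                    =O_ (0 : R) (fun eps : R => eps ^+ 2) &
                (\forall eps \near (0 : R)^'+, forall i j : 'I_r,
                   (i < j)%N -> x i eps < x j eps) /\
                (\forall eps \near (0 : R)^'-, forall i j : 'I_r,
                   (i < j)%N -> x j eps < x i eps)]]].
Proof.
move=> p q h I J m k r U V Q ctan hz _ _ nmk.
have [Qm Qsz] : Q \is monic /\ size Q = r.+1 by exact: tangent_monic.
have ctan0 : ctan != 0 by exact: ctan_neq0.
have [S hS] : exists S : {poly {poly R}}, forall e,
    h e \Po ((a + b)%:P + e *: 'X) = e ^+ r *: (ctan *: Q + e *: S.[e%:P]).
  exact: h_zoom_family.
have hm e : h e \is monic by have [] := h_monic alpha beta u v e.
have hsz e : size (h e) = n.+1 by have [] := h_monic alpha beta u v e.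
have hc i : (fun e => (h e)`_i) @ (0 : R) --> (h 0)`_i by exact: h_cvg.
have Qreal w : w \in croots Q -> complex.Im w = 0 by exact: tangent_real.
split => //; first by exists S.
  split; last exact: locally_uniform_zoom hS.
  move=> i; have zc : (fun e => (ctan *: Q + e *: S.[e%:P])`_i) @ (0 : R)^' --> (ctan *: Q)`_i.
    have zc : (fun e => (ctan *: Q + e *: S.[e%:P])`_i) @ (0 : R) --> (ctan *: Q)`_i.
      exact: cvg_zoomed_coef.
    by apply: cvg_trans zc; apply: cvg_app; exact: nbhs_dnbhs.
  apply: cvg_trans zc; apply: near_eq_cvg; near=> e.
  have e0 : e != 0 by near: e; exact: nbhs_dnbhs_neq.
  by rewrite /hz hS coefZ mulKf // expf_neq0.
split.
- exact: (cluster_size hm hsz hc Qm Qsz ctan0 hS).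
- exact: (cluster_rescaled hm hsz hc Qm Qsz ctan0 hS).
- exact: (cluster_analytic hm hsz hc Qm Qsz ctan0 hS).
Unshelve. all: by end_near.
Qed.
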